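(* Let $(M^n,g)$ be a complete noncompact $n$-dimensional Riemannian manifold, $u\in C^\infty(M)$, $V=e^u$, $\lambda,\mu\in\mathbb{R}$, $D=D^{\lambda,\mu}$, and $\tau=(n+1)\lambda+\mu$. Let $\rho$ be a nonnegative function on $M$ such that $|\nabla^D\rho|=1$ in the sense of distributions, and let $\alpha\in\mathbb{R}$. Then for every compactly supported smooth function $\phi\in C_0^\infty(M\setminus\rho^{-1}\{0\})$: (i) If $\Delta^D\rho\le \frac{C}{\rho}V^{\lambda-\mu}$ in the sense of distributions, where $C>0$ is a constant and $1-\alpha-C>0$, then $$\int_M\rho^\alpha|\nabla^D\phi|^2V^{\tau+\lambda-\mu}\,dv_g\ \ge\ \left(\frac{1-\alpha-C}{2}\right)^2\int_M\rho^{\alpha-2}\phi^2V^{\tau+\lambda-\mu}\,dv_g.$$ (ii) If $\Delta^D\rho\ge \frac{C}{\rho}V^{\lambda-\mu}$ in the sense of distributions, where $C>0$ is a constant and $C+\alpha-1>0$, then $$\int_M\rho^\alpha|\nabla^D\phi|^2V^{\tau+\lambda-\mu}\,dv_g\ \ge\ \left(\frac{\alpha+C-1}{2}\right)^2\int_M\rho^{\alpha-2}\phi^2V^{\tau+\lambda-\mu}\,dv_g.$$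
   Context: $\nabla$, $\Delta=\mathrm{div}\,\nabla$, $dv_g$ denote the Levi-Civita connection/gradient, Laplacian and Riemannian volume of $g$; $\langle\cdot,\cdot\rangle=g$ and $|\cdot|$ is the norm of $g$. The affine connection $D=D^{\lambda,\mu}$ is $D_XY=\nabla_XY+\lambda\,du(X)Y+\lambda\,du(Y)X+\mu\,g(X,Y)\nabla u$. The affine gradient of a function $f$ is $\nabla^Df=V^{\mu-\lambda}\nabla f$. The affine Laplacian is $\Delta^Df=V^{\mu-\lambda}\left[\Delta f+(2\mu+n\lambda)\langle\nabla u,\nabla f\rangle\right]$; equivalently $V^\tau\Delta^Df=\mathrm{div}(V^\tau\nabla^Df)$. Distributional conditions: ''$|\nabla^D\rho|=1$ in the sense of distributions'' means that $\rho$ is locally Lipschitz and its (weak) gradient satisfies $|\nabla^D\rho|=1$ almost everywhere. ''$\Delta^D\rho\ge\frac{C}{\rho}V^{\lambda-\mu}$ in the sense of distributions'' means that $-\int_M\langle\nabla\psi,\nabla^D\rho\rangle V^\tau\,dv_g\ge\int_M\frac{C}{\rho}\psi V^{\tau+\lambda-\mu}\,dv_g$ for all nonnegative compactly supported Lipschitz $\psi$ with support in $M\setminus\rho^{-1}\{0\}$; the condition with $\le$ is the same with the inequality reversed. *)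

(* Defs.v *)
From HB Require Import structures.
From mathcomp Require Import all_boot all_order all_algebra.
From mathcomp Require Import all_classical all_reals all_analysis.

Set Implicit Arguments.
Unset Strict Implicit.
Unset Printing Implicit Defensive.

Import Order.TTheory GRing.Theory Num.Theory.
Import numFieldNormedType.Exports.

Local Open Scope classical_set_scope.
Local Open Scope ring_scope.

Definition borel (T : ptopologicalType) := g_sigma_algebraType (@open T).

Section Manifold.
Context {R : realType} {n : nat}.

Fixpoint continuously_differentiable {W : normedModType R} (k : nat)
    (U : set 'rV[R]_n) (f : 'rV[R]_n -> W) : Prop :=
  (forall x, U x -> {for x, continuous f}) /\
  if k is k'.+1 then
    forall v : 'rV[R]_n, (forall x, U x -> derivable f x v) /\
      continuously_differentiable k' U (fun x => 'D_v f x)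
  else True.

(* to be used on open sets U only *)
Definition smooth_on {W : normedModType R}
    (U : set 'rV[R]_n) (f : 'rV[R]_n -> W) : Prop :=
  forall k, continuously_differentiable k U f.

Record chart (M : topologicalType) := Chart {
  dom : set M;
  coord :> M -> 'rV[R]_n;
  param : 'rV[R]_n -> M;
  dom_open : open dom;
  codom_open : open (coord @` dom);
  coordK : forall p, dom p -> param (coord p) = p;
  coord_continuous : forall p, dom p -> {for p, continuous coord};
  param_continuous :
    forall x, (coord @` dom) x -> {for x, continuous param} }.

(* [chart_at p] is a chosen chart around [p]; a tangent vector at [p] is
   represented by its components in the chart [chart_at p]. *)
Record smooth_structure (M : topologicalType) := SmoothStructure {
  atlas : set (chart M);
  chart_at : M -> chart M;
  chart_at_atlas : forall p, atlas (chart_at p);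
  chart_at_dom : forall p, dom (chart_at p) p;
  transition_smooth : forall c c', atlas c -> atlas c' ->
    smooth_on (c @` (dom c `&` dom c')) (c' \o param c);
  manifold_hausdorff : hausdorff_space M;
  manifold_second_countable : @second_countable M }.

Definition smooth_fun (M : topologicalType) (S : smooth_structure M)
    (f : M -> R) : Prop :=
  forall c, atlas S c -> smooth_on (c @` dom c) (f \o param c).

(* [gmx c x] is the matrix (g_ij) at the point of coordinates [x] in the
   chart [c]. With row vectors, a tangent vector of components [v] in [c] has
   components [v *m 'J (c' \o param c) x] in [c']. *)
Record riemannian_metric (M : topologicalType) (S : smooth_structure M) :=
  RiemannianMetric {
  gmx : chart M -> 'rV[R]_n -> 'M[R]_n;
  gmx_smooth : forall c, atlas S c -> smooth_on (c @` dom c) (gmx c);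
  gmx_sym : forall c p, atlas S c -> dom c p -> (gmx c (c p))^T = gmx c (c p);
  gmx_pos : forall c p (v : 'rV[R]_n), atlas S c -> dom c p -> v != 0 ->
    0 < (v *m gmx c (c p) *m v^T) 0 0;
  gmx_compat : forall c c' p, atlas S c -> atlas S c' ->
    dom c p -> dom c' p ->
    gmx c (c p) = 'J (c' \o param c) (c p) *m gmx c' (c' p)
                    *m ('J (c' \o param c) (c p))^T }.

Section Riemannian.
Context {M : topologicalType} {S : smooth_structure M}.
Variable g : riemannian_metric S.

Definition gmx_at (p : M) : 'M[R]_n := gmx g (chart_at S p) (chart_at S p p).

Definition inner (p : M) (v w : 'rV[R]_n) : R := (v *m gmx_at p *m w^T) 0 0.

Definition tnorm (p : M) (v : 'rV[R]_n) : R := Num.sqrt (inner p v v).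

Definition mdifferentiable (f : M -> R) (p : M) : Prop :=
  differentiable (f \o param (chart_at S p)) (chart_at S p p).

Definition partials (f : M -> R) (p : M) : 'rV[R]_n :=
  \row_i 'd (f \o param (chart_at S p)) (chart_at S p p) (delta_mx 0 i).

(* The gradient g^{ij} d_j f, with value 0 where f is not differentiable. For
   a locally Lipschitz f, this happens on a null set only (Rademacher), and
   the result is (a representative of) the weak gradient. *)
Definition grad (f : M -> R) (p : M) : 'rV[R]_n :=
  if `[< mdifferentiable f p >] then partials f p *m invmx (gmx_at p) else 0.

Lemma gmx_at_unit p : gmx_at p \in unitmx.
Proof.
rewrite -row_free_unit -kermx_eq0; apply/rowV0P => v /sub_kermxP vg0.
apply/eqP; apply: contraT => v0.
have := gmx_pos g (chart_at_atlas S p) (chart_at_dom S p) v0.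
by rewrite -/(gmx_at p) vg0 mul0mx mxE ltxx.
Qed.

Lemma inner_grad f p v : mdifferentiable f p ->
  inner p (grad f p) v = 'd (f \o param (chart_at S p)) (chart_at S p p) v.
Proof.
move=> df; rewrite /inner /grad asboolT// mulmxKV ?gmx_at_unit//.
rewrite mxE [in RHS](row_sum_delta v) linear_sum; apply: eq_bigr => i _.
by rewrite !mxE linearZ /= mulrC.
Qed.

Definition velocity (gam : R -> M) (t : R) : 'rV[R]_n :=
  derive1 (chart_at S (gam t) \o gam) t.

(* C^1 on a neighbourhood of [0, 1] *)
Definition C1_curve (gam : R -> M) : Prop :=
  forall t, 0 <= t <= 1 ->
    {for t, continuous gam} /\
    forall c : chart M, atlas S c -> dom c (gam t) ->
      (\forall s \near t, derivable (c \o gam) s 1) /\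
      {for t, continuous (derive1 (c \o gam))}.

Definition curve_length (gam : R -> M) : \bar R :=
  (\int[lebesgue_measure]_(t in `[0%R, 1%R])
     (tnorm (gam t) (velocity gam t))%:E)%E.

(* [piecewise_C1_path p q l]: a piecewise C^1 path from p to q of length l *)
Inductive piecewise_C1_path (p : M) : M -> \bar R -> Prop :=
| path_nil : piecewise_C1_path p p 0%E
| path_rcons (gam : R -> M) (l : \bar R) :
    piecewise_C1_path p (gam 0) l -> C1_curve gam ->
    piecewise_C1_path p (gam 1) (l + curve_length gam)%E.

(* +oo if p and q lie in different connected components *)
Definition rdist (p q : M) : \bar R :=
  ereal_inf [set l | piecewise_C1_path p q l].

Definition complete_metric : Prop :=
  forall x : nat -> M,
    (forall e : R, 0 < e -> exists N : nat, forall i j : nat,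
       (N <= i)%N -> (N <= j)%N -> (rdist (x i) (x j) < e%:E)%E) ->
    exists p : M, x @ \oo --> p.

Definition lipschitz_with (K : R) (A : set M) (f : M -> R) : Prop :=
  forall p q, A p -> A q -> (`|f p - f q|%:E <= K%:E * rdist p q)%E.

Definition lipschitz_fun (f : M -> R) : Prop :=
  exists K, lipschitz_with K setT f.

Definition locally_lipschitz_fun (f : M -> R) : Prop :=
  forall p : M, exists K, exists2 U, nbhs p U & lipschitz_with K U f.

End Riemannian.

Definition compactly_supported_in {M : topologicalType} (A : set M)
    (f : M -> R) : Prop :=
  compact (closure [set p | f p != 0]) /\ closure [set p | f p != 0] `<=` A.

Definition is_lebesgue_rV
    (L : {measure set (borel 'rV[R]_n) -> \bar R}) : Prop :=
  forall a b : 'rV[R]_n, (forall i, a 0 i <= b 0 i) ->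
    L [set x : 'rV[R]_n | forall i, a 0 i <= x 0 i <= b 0 i] =
      (\prod_i (b 0 i - a 0 i))%:E.

(* dv_g = sqrt (det (g_ij)) dx in every chart; this determines [vol]. *)
Definition is_riemannian_volume {M : ptopologicalType}
    {S : smooth_structure M} (g : riemannian_metric S)
    (vol : {measure set (borel M) -> \bar R}) : Prop :=
  exists2 L : {measure set (borel 'rV[R]_n) -> \bar R}, is_lebesgue_rV L &
    forall (c : chart M) (A : set (borel M)),
      atlas S c -> measurable A -> A `<=` dom c ->
      vol A = (\int[L]_(x in c @` A) (Num.sqrt (\det (gmx g c x)))%:E)%E.

Section Affine.
Context {M : ptopologicalType} {S : smooth_structure M}.
Variables (g : riemannian_metric S) (vol : {measure set (borel M) -> \bar R}).
Variables (u : M -> R) (lam mu : R).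

(* V^a, where V = e^u *)
Definition weight (a : R) (p : M) : R := expR (u p) `^ a.

Definition tau : R := n.+1%:R * lam + mu.

(* grad^D f = V^(mu - lambda) grad f, for the affine connection
   D_X Y = nabla_X Y + lambda du(X) Y + lambda du(Y) X + mu g(X, Y) grad u *)
Definition affine_grad (f : M -> R) (p : M) : 'rV[R]_n :=
  weight (mu - lam) p *: grad g f p.

Definition unit_affine_grad (rho : M -> R) : Prop :=
  locally_lipschitz_fun g rho /\
  {ae vol, forall p, tnorm g p (affine_grad rho p) = 1}.

(* the pairing of psi with V^tau Delta^D rho = div (V^tau grad^D rho) *)
Definition weak_affine_laplacian (rho psi : M -> R) : \bar R :=
  (- \int[vol]_p
       (inner g p (grad g psi p) (affine_grad rho p) * weight tau p)%:E)%E.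

Definition laplacian_bound (C : R) (rho psi : M -> R) : \bar R :=
  (\int[vol]_p (C / rho p * psi p * weight (tau + lam - mu) p)%:E)%E.

Definition test_function (rho psi : M -> R) : Prop :=
  [/\ forall p, 0 <= psi p, lipschitz_fun g psi &
      compactly_supported_in [set p | rho p != 0] psi].

(* Delta^D rho <= (C / rho) V^(lambda - mu) in the sense of distributions *)
Definition affine_laplacian_le (C : R) (rho : M -> R) : Prop :=
  forall psi, test_function rho psi ->
    (weak_affine_laplacian rho psi <= laplacian_bound C rho psi)%E.

Definition affine_laplacian_ge (C : R) (rho : M -> R) : Prop :=
  forall psi, test_function rho psi ->
    (laplacian_bound C rho psi <= weak_affine_laplacian rho psi)%E.

End Affine.

End Manifold.
Arguments tau {R} n lam mu.

(* Main.v *)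
(** The Laplacian comparison is tested against psi = rho^(alpha-1) phi^2. Where
    |grad^D rho| = 1 the product rule turns its left-hand side into
    (1 - alpha) rho^(alpha-2) phi^2 minus a cross term
    2 rho^(alpha-1) phi <grad phi, grad^D rho>, and the cross term is absorbed
    by Cauchy-Schwarz and AM-GM with weight b = |1 - alpha - C|:
    2 x y <= (b/2) x^2 + (2/b) y^2. No appeal to Rademacher's theorem is made:
    [grad] vanishes at points of non-differentiability, so that
    |grad^D rho| = 1 already forces differentiability almost everywhere.

    It remains to see that psi is an admissible test function, i.e. globally
    Lipschitz for the Riemannian distance. Along a C^1 curve, a function that is
    Lipschitz near every point, with a constant that compactness makes uniform,
    varies at most at the rate (constant) x (speed); integrating this gives the
    bound by the length. Continuity of rho comes from the short coordinate
    segments that join nearby points. *)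

Require Import Defs.
From HB Require Import structures.
From mathcomp Require Import all_boot all_order all_algebra.
From mathcomp Require Import all_classical all_reals all_analysis.
From mathcomp Require Import measurable_realfun ring lra.

Set Implicit Arguments.
Unset Strict Implicit.
Unset Printing Implicit Defensive.

Import Order.TTheory GRing.Theory Num.Theory.
Import numFieldNormedType.Exports.

Local Open Scope classical_set_scope.
Local Open Scope ring_scope.

(** * Differentiability of C^1 functions of several variables *)

Lemma is_derive_line (R : realType) (V W : normedModType R) (f : V -> W)
    (z e : V) (t : R) :
  derivable f (z + t *: e) e ->
  is_derive t 1 (fun s => f (z + s *: e)) ('D_e f (z + t *: e)).
Proof.
have E : (fun h : R => h^-1 *: (((fun s => f (z + s *: e)) \o shift t) (h *: 1)
             - f (z + t *: e))) =
         (fun h : R => h^-1 *: ((f \o shift (z + t *: e)) (h *: e)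
             - f (z + t *: e))).
  apply/funext => h /=; congr (_ *: (f _ - _)).
  by rewrite [h *: 1]mulr1 scalerDl addrCA.
by move=> df; split; rewrite /derivable /derive E.
Qed.

(** The endpoints may come in either order, because increments of unknown sign are fed in. The
    segment is therefore replaced by the symmetric interval of radius |b - a| about a. *)
Lemma MVT_sym (R : realType) (f df : R -> R) (a b : R) :
  (forall x, `|x - a| <= `|b - a| -> is_derive x 1 f (df x)) ->
  exists2 c, `|c - a| <= `|b - a| & f b - f a = df c * (b - a).
Proof.
have MVTle (a' b' : R) : a' <= b' ->
    (forall x, a' <= x <= b' -> is_derive x 1 f (df x)) ->
    exists2 c, a' <= c <= b' & f b' - f a' = df c * (b' - a').
  move=> ab dfx; have [||c cab ->] := @MVT_segment R f df a' b' ab.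
  - by move=> x /[!in_itv]/= /andP[ax xb]; apply: dfx; rewrite !ltW.
  - apply: derivable_within_continuous => x /[!in_itv]/= xab.
    by have [] := dfx _ xab.
  - by exists c => //; move: cab; rewrite in_itv.
move=> dfx; case: (leP a b) => ab.
- have [x /andP[ax xb]|c /andP[ac cb] E] := MVTle a b ab.
    by apply: dfx; rewrite !ger0_norm ?subr_ge0 ?lerD2r.
  by exists c => //; rewrite !ger0_norm ?subr_ge0 ?lerD2r.
- have [|x /andP[ax xb]|c /andP[ac cb] E] := MVTle b a; first exact: ltW.
    by apply: dfx; rewrite !ler0_norm ?subr_le0 ?lerN2 ?lerD2r// ltW.
  exists c; first by rewrite !ler0_norm ?subr_le0 ?lerN2 ?lerD2r// ltW.
  by rewrite -[LHS]opprB E -mulrN opprB.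
Qed.

Section C1.
Context {R : realType} {n : nat}.
Implicit Types (U : set 'rV[R]_n) (x h : 'rV[R]_n).

(* One coordinate is moved at a time, with the mean value theorem for each move. *)
Lemma C1_first_order (f : 'rV[R]_n -> R) U x : open U -> U x ->
  (forall i y, U y -> derivable f y (delta_mx 0 i)) ->
  (forall i, {for x, continuous (fun y => 'D_(delta_mx 0 i) f y)}) ->
  forall (s : seq 'I_n) (eps : R), 0 < eps -> \forall h \near (0 : 'rV[R]_n),
    `|f (x + \sum_(i <- s) (h : 'rV[R]_n) 0 i *: delta_mx 0 i) - f x
      - \sum_(i <- s) h 0 i * 'D_(delta_mx 0 i) f x| <= eps * `|h|.
Proof.
move=> oU Ux df cdf; elim=> [|i s IH] eps eps0.
  by near=> h; rewrite !big_nil addr0 subrr subr0 normr0 mulr_ge0// ltW.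
have e20 : 0 < eps / 2 by rewrite divr_gt0.
(* Half of [eps] pays for the oscillation of the new partial derivative on this ball, the other half
   for the induction hypothesis. *)
have /nbhs_normP[r /= r0 rU] : \forall y \near x,
    U y /\ `|'D_(delta_mx 0 i) f x - 'D_(delta_mx 0 i) f y| <= eps / 2.
  apply: filterI; first exact: open_nbhs_nbhs.
  by have /cvgrPdist_le := cdf i; exact.
have coord_le h j : `|h 0 j| <= `|h|.
  rewrite [leRHS]/Num.Def.normr/= mx_normrE.
  exact: (le_bigmax 0 (fun ij : 'I_1 * 'I_n => `|h ij.1 ij.2|) (0, j)).
have deltan j : `|delta_mx 0 j : 'rV[R]_n| <= 1.
  rewrite /Num.Def.normr/= mx_normrE; apply: bigmax_le => // -[a b] _ /=.
  by rewrite mxE; case: (_ && _); rewrite ?normr1 ?normr0.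
have sumn h (s' : seq 'I_n) :
    `|\sum_(j <- s') h 0 j *: delta_mx 0 j : 'rV[R]_n| <= (size s')%:R * `|h|.
  elim: s' => [|j s' IHs]; first by rewrite big_nil normr0 mul0r.
  rewrite big_cons (le_trans (ler_normD _ _))//= -natr1 mulrDl addrC.
  by rewrite lerD// normrZ mulrC ler_pM.
near=> h.
(* Each move has length at most |h|. The moves along [s] and the current one thus stay in the ball
   of radius r. *)
have hr : (size s).+1%:R * `|h| < r.
  rewrite mulrC -ltr_pdivlMr//; near: h.
  by apply: (@nbhs0_lt R 'rV[R]_n); rewrite divr_gt0.
set z := x + \sum_(j <- s) h 0 j *: delta_mx 0 j.
have zin t : `|t - 0| <= `|h 0 i - 0| ->
    U (z + t *: delta_mx 0 i) /\ `|'D_(delta_mx 0 i) f x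
       - 'D_(delta_mx 0 i) f (z + t *: delta_mx 0 i)| <= eps / 2.
  rewrite !subr0 => th; apply: rU => /=; apply: le_lt_trans hr.
  rewrite /z -!addrA opprD addNKr normrN (le_trans (ler_normD _ _))//.
  rewrite -natr1 mulrDl lerD//.
  by rewrite normrZ mulrC ler_pM//; exact: le_trans th _.
have [|c /zin[Uc Dc] /= E] := @MVT_sym R (fun t => f (z + t *: delta_mx 0 i))
    (fun t => 'D_(delta_mx 0 i) f (z + t *: delta_mx 0 i)) 0 (h 0 i).
  by move=> t /zin[Ut _]; apply: is_derive_line; exact: df.
rewrite !big_cons [h 0 i *: _ + _]addrC addrA -/z.
move: E; rewrite scale0r addr0 subr0 => /(canRL (subrK _)) ->.
rewrite [X in `|X|](_ : _ =
  ('D_(delta_mx 0 i) f (z + c *: delta_mx 0 i)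
    - 'D_(delta_mx 0 i) f x) * h 0 i + (f z - f x -
  \sum_(j <- s) h 0 j * 'D_(delta_mx 0 j) f x)); last by ring.
apply: (le_trans (ler_normD _ _)); rewrite (splitr eps) [leRHS]mulrDl; apply: lerD.
  by rewrite normrM ler_pM// distrC.
by rewrite /z; near: h; exact: IH.
Unshelve. all: by end_near. Qed.

(** The candidate differential is h |-> h *m D, with D the column of partial derivatives.
    [C1_first_order] over all coordinates says that its error is o(h), and uniqueness of the
    differential concludes. *)
Lemma C1_differentiable (f : 'rV[R]_n -> R) U x : open U -> U x ->
  (forall i y, U y -> derivable f y (delta_mx 0 i)) ->
  (forall i, {for x, continuous (fun y => 'D_(delta_mx 0 i) f y)}) ->
  differentiable f x.
Proof.
move=> oU Ux df cdf.
pose D : 'cV[R]_n := \col_i 'D_(delta_mx 0 i) f x.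
pose L (h : 'rV[R]_n) : R := (h *m D) 0 0.
have Ll : linear L by move=> a u v; rewrite /L mulmxDl -scalemxAl !mxE.
pose LL : {linear 'rV[R]_n -> R} :=
  HB.pack L (GRing.isLinear.Build R 'rV[R]_n R _ L Ll).
have LE h : LL h = \sum_(i <- enum 'I_n) h 0 i * 'D_(delta_mx 0 i) f x.
  rewrite /LL/= /L mxE big_enum; apply: eq_bigr => i _.
  by rewrite mxE.
have Lc : continuous LL.
  have LE' : L = \sum_i (fun h : 'rV[R]_n => h 0 i * 'D_(delta_mx 0 i) f x).
    by apply/funext => k; rewrite -[LHS]/(LL k) LE big_enum fct_sumE.
  suff dL h : differentiable L h.
    by move=> h; exact: (@differentiable_continuous _ 'rV[R]_n R h L).
  rewrite LE'; apply: differentiable_sum => i.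
  by apply: differentiableM => //; exact: differentiable_coord.
have fo : f \o shift x = cst (f x) + LL +o_ (nbhs (0 : 'rV[R]_n)) id.
  apply/(@eqaddoP R 'rV[R]_n R 'rV[R]_n _ _ _ _) => eps eps0.
  apply: filterS (C1_first_order oU Ux df cdf (enum 'I_n) eps0) => h.
  rewrite -LE !fctE /= big_enum -row_sum_delta [h + x]addrC opprD addrA.
  exact.
apply/diff_locallyP.
have -> : 'd f x = LL :> (_ -> _) by exact: diff_unique.
by split.
Qed.

End C1.

(** * Charts and changes of coordinates *)

Lemma near_eq_continuous (T U : topologicalType) (f h : T -> U) (x : T) :
  (\forall y \near x, f y = h y) ->
  {for x, continuous f} -> {for x, continuous h}.
Proof.
move=> fh fc; rewrite /prop_for /continuous_at -(nbhs_singleton fh).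
apply: cvg_trans fc; apply: near_eq_cvg.
by apply: filterS fh => y ->.
Qed.

Lemma continuous_near (T U : topologicalType) (f : T -> U) (x : T) (A : set U) :
  {for x, continuous f} -> nbhs (f x) A -> \forall y \near x, A (f y).
Proof. by move=> fc /fc. Qed.

Section SmoothOn.
Context {R : realType} {n : nat} {W : normedModType R}.
Variables (U : set 'rV[R]_n) (f : 'rV[R]_n -> W).
Hypothesis fU : smooth_on U f.

Lemma smooth_on_continuous x : U x -> {for x, continuous f}.
Proof. by move=> Ux; have [/(_ x Ux)] := fU 0. Qed.

Lemma smooth_on_derivable x v : U x -> derivable f x v.
Proof. by move=> Ux; have [_ /(_ v)[+ _]] := fU 1; exact. Qed.

Lemma smooth_on_continuous_derive x v : U x -> {for x, continuous ('D_v f)}.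
Proof. by move=> Ux; have [_ /(_ v)[_ [+ _]]] := fU 1; exact. Qed.

End SmoothOn.
Arguments smooth_on_derivable {R n W U f} fU x v Ux.
Arguments smooth_on_continuous_derive {R n W U f} fU x v Ux.

Lemma smooth_on_differentiable (R : realType) (n : nat) (U : set 'rV[R]_n)
    (f : 'rV[R]_n -> R) x :
  open U -> smooth_on U f -> U x -> differentiable f x.
Proof.
move=> oU fU Ux; apply: (C1_differentiable oU Ux) => [i y Uy|i].
  exact: smooth_on_derivable fU _ _ Uy.
exact: smooth_on_continuous_derive fU _ _ Ux.
Qed.

Lemma mx_entry_continuous (R : realType) (T : topologicalType) (m n : nat)
    (A : T -> 'M[R]_(m, n)) x i j :
  {for x, continuous A} -> {for x, continuous (fun y => A y i j)}.
Proof.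
move=> cA; apply: (@continuous_comp _ _ _ A (fun M : 'M[R]_(m, n) => M i j)) => //.
exact: coord_continuous.
Qed.

Lemma smooth_on_differentiable_rV (R : realType) (n m : nat)
    (U : set 'rV[R]_n) (f : 'rV[R]_n -> 'rV[R]_m) x :
  open U -> smooth_on U f -> U x -> differentiable f x.
Proof.
move=> oU fU Ux.
(* Writing f in the standard basis reduces the claim to its scalar components. *)
rewrite (_ : f = \sum_j (fun y => f y 0 j *: delta_mx 0 j)); last first.
  by apply/funext => y; rewrite fct_sumE [LHS]row_sum_delta.
apply: differentiable_sum => j; apply: differentiableZl.
have dfj y v : U y -> derivable (fun z => f z 0 j) y v.
  by move=> Uy; have /derivable_mxP := smooth_on_derivable fU _ v Uy; exact.
apply: (C1_differentiable oU Ux) => [i y Uy|i]; first exact: dfj.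
have /mx_entry_continuous := smooth_on_continuous_derive fU _ (delta_mx 0 i) Ux.
move=> /(_ 0 j); apply: near_eq_continuous.
have := open_nbhs_nbhs (conj oU Ux); apply: filterS => y Uy.
rewrite derive_mx ?mxE//; exact: smooth_on_derivable fU _ _ Uy.
Qed.

Section Charts.
Context {R : realType} {n : nat} {M : topologicalType}.
Implicit Types (c : @chart R n M) (p : M).

Lemma nbhs_dom c p : dom c p -> nbhs p (dom c).
Proof. by move=> cp; apply: open_nbhs_nbhs; split => //; exact: dom_open. Qed.

Lemma chart_near c p (P : set M) : dom c p -> nbhs p P ->
  \forall x \near c p, [/\ P (param c x), dom c (param c x) & c (param c x) = x].
Proof.
move=> cp pP.
have cpin : (c @` dom c) (c p) by exists p.
have cont := param_continuous cpin.
have : \forall x \near c p, (c @` dom c) x.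
  by apply: open_nbhs_nbhs; split => //; exact: codom_open.
have : \forall x \near c p, P (param c x).
  by apply: cont; rewrite /= coordK.
apply: filterS2 => x Px [q cq qx]; rewrite -qx coordK//; split => //.
by rewrite -(coordK cq) qx.
Qed.

Lemma open_chart_image c (A : set M) : open A -> open (c @` (dom c `&` A)).
Proof.
move=> oA; rewrite openE => _ [p [cp Ap] <-].
have : nbhs p A by exact: open_nbhs_nbhs.
move=> /(chart_near cp); apply: filterS => x [Ax cx E].
by exists (param c x).
Qed.

Lemma chart_near_pullback c p (P : set 'rV[R]_n) : dom c p -> nbhs (c p) P ->
  \forall q \near p, dom c q /\ P (c q).
Proof.
move=> cp cP; apply: filterI.
  exact: nbhs_dom.
exact: (Defs.coord_continuous cp).
Qed.

Context {S : @smooth_structure R n M}.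
Implicit Types (f : M -> R).

Lemma transition_differentiable c c' p :
  atlas S c -> atlas S c' -> dom c p -> dom c' p ->
  differentiable (c' \o param c) (c p).
Proof.
move=> Sc Sc' cp c'p.
apply: smooth_on_differentiable_rV (transition_smooth Sc Sc') _; last by exists p.
exact: open_chart_image (@dom_open _ _ _ c').
Qed.

Lemma smooth_fun_differentiable f c p :
  smooth_fun S f -> atlas S c -> dom c p -> differentiable (f \o param c) (c p).
Proof.
move=> Sf Sc cp.
have cpc : (c @` dom c) (c p) by exists p.
exact: (smooth_on_differentiable (@codom_open _ _ _ c) (Sf c Sc) cpc).
Qed.

Lemma smooth_fun_continuous f : smooth_fun S f -> continuous f.
Proof.
move=> Sf p; set c := chart_at S p.
have cp : dom c p by exact: chart_at_dom.
have Sc : atlas S c by exact: chart_at_atlas.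
have /differentiable_continuous := smooth_fun_differentiable Sf Sc cp.
move=> H; have {H} : {for p, continuous ((f \o param c) \o c)}.
  by apply: continuous_comp => //; exact: Defs.coord_continuous.
apply: near_eq_continuous.
by have := nbhs_dom cp; apply: filterS => q cq /=; rewrite coordK.
Qed.

(** Chain rule: near c p, f read in c is f read in c' composed with the transition map. *)
Lemma diff_transition f c c' p v :
  atlas S c -> atlas S c' -> dom c p -> dom c' p ->
  differentiable (f \o param c') (c' p) ->
  differentiable (f \o param c) (c p) ->
  'd (f \o param c) (c p) v =
  'd (f \o param c') (c' p) (v *m 'J (c' \o param c) (c p)).
Proof.
move=> Sc Sc' cp c'p df' df.
have dT := transition_differentiable Sc Sc' cp c'p.
transitivity ('D_v (f \o param c) (c p)); first by rewrite deriveE.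
have E : \forall x \near c p,
    (f \o param c) x = ((f \o param c') \o (c' \o param c)) x.
  have := chart_near cp (nbhs_dom c'p).
  by apply: filterS => x [c'x _ _] /=; rewrite coordK.
rewrite (near_eq_derive _ E).
have df'' : differentiable (f \o param c') ((c' \o param c) (c p)).
  by rewrite /= coordK.
rewrite deriveE; last exact: differentiable_comp.
have /(congr1 (@^~ v)) H := diff_comp dT df''; apply: etrans H _.
rewrite /jacobian mul_rV_lin1 /=.
by rewrite coordK.
Qed.

End Charts.

(** * The metric in coordinates and the Cauchy-Schwarz inequality *)

Section Metric.
Context {R : realType} {n : nat} {M : topologicalType} {S : @smooth_structure R n M}.
Variable g : riemannian_metric S.
Implicit Types (c : @chart R n M) (p : M) (f : M -> R).

Lemma gmx_unit c p : atlas S c -> dom c p -> gmx g c (c p) \in unitmx.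
Proof.
move=> Sc cp; rewrite -row_free_unit -kermx_eq0; apply/rowV0P => v /sub_kermxP vg0.
apply/eqP; apply: contraT => v0.
by have := gmx_pos g Sc cp v0; rewrite vg0 mul0mx mxE ltxx.
Qed.

(** Read off from the transformation law of the metric: J is a square factor of the invertible
    matrix J G' J^T. *)
Lemma jacobian_unit c c' p : atlas S c -> atlas S c' -> dom c p -> dom c' p ->
  'J (c' \o param c) (c p) \in unitmx.
Proof.
move=> Sc Sc' cp c'p; have := gmx_unit Sc cp.
by rewrite (gmx_compat g Sc Sc' cp c'p) !unitmx_mul => /andP[/andP[]].
Qed.

Definition chart_partials f c x : 'rV[R]_n :=
  \row_i 'D_(delta_mx 0 i) (f \o param c) x.

Lemma partialsE f p : mdifferentiable (S:=S) f p ->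
  partials (S:=S) f p = chart_partials f (chart_at S p) (chart_at S p p).
Proof. by move=> df; apply/rowP => i; rewrite !mxE deriveE. Qed.

Lemma chart_partials_transition f c c' p :
  atlas S c -> atlas S c' -> dom c p -> dom c' p ->
  differentiable (f \o param c') (c' p) ->
  differentiable (f \o param c) (c p) ->
  chart_partials f c (c p) =
  chart_partials f c' (c' p) *m ('J (c' \o param c) (c p))^T.
Proof.
move=> Sc Sc' cp c'p df' df; apply/rowP => i.
rewrite !mxE deriveE// (diff_transition _ Sc Sc')// -rowE.
rewrite [X in 'd _ _ X](row_sum_delta) linear_sum/=; apply: eq_bigr => j _.
by rewrite !mxE linearZ/= deriveE// mulrC.
Qed.

(** The squared norm of df for the dual metric g^{ij}, that is |grad f|^2 read in an arbitrary
    chart. [grad] and [tnorm] use the chart chosen at each point, which may jump from point to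
    point. *)
Definition grad_sqnorm f c x : R :=
  (chart_partials f c x *m invmx (gmx g c x) *m (chart_partials f c x)^T) 0 0.

(** With P = P' J^T and G = J G' J^T, the Jacobians cancel in P G^{-1} P^T. *)
Lemma grad_sqnorm_transition f c c' p :
  atlas S c -> atlas S c' -> dom c p -> dom c' p ->
  differentiable (f \o param c') (c' p) ->
  differentiable (f \o param c) (c p) ->
  grad_sqnorm f c (c p) = grad_sqnorm f c' (c' p).
Proof.
move=> Sc Sc' cp c'p df' df; rewrite /grad_sqnorm.
rewrite (chart_partials_transition Sc Sc' cp c'p)//.
rewrite (gmx_compat g Sc Sc' cp c'p).
set J := 'J _ _; set P := chart_partials _ _ _; set G := gmx _ _ _.
have uJ : J \in unitmx by exact: jacobian_unit.
have uG : G \in unitmx by exact: gmx_unit.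
have uJT : J^T \in unitmx by rewrite unitmx_tr.
have -> : invmx (J *m G *m J^T) = invmx J^T *m invmx G *m invmx J.
  apply: (can_inj (mulKmx (_ : J *m G *m J^T \in unitmx))).
    by rewrite !unitmx_mul uJ uG uJT.
  rewrite mulmxV; last by rewrite !unitmx_mul uJ uG uJT.
  by rewrite !mulmxA mulmxK// mulmxK// mulmxV.
congr (_ 0 0); rewrite trmx_mul trmxK !mulmxA mulmxK//.
by rewrite mulmxKV.
Qed.

Lemma diff_chart_partials f c x v : differentiable (f \o param c) x ->
  'd (f \o param c) x v = (v *m (chart_partials f c x)^T) 0 0.
Proof.
move=> df; rewrite [X in 'd _ _ X](row_sum_delta) linear_sum/= mxE.
by apply: eq_bigr => j _; rewrite !mxE linearZ/= deriveE.
Qed.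

Lemma inner_grad_self f p : mdifferentiable (S:=S) f p ->
  inner g p (grad g f p) (grad g f p) =
  grad_sqnorm f (chart_at S p) (chart_at S p p).
Proof.
move=> df; rewrite inner_grad// diff_chart_partials// /grad asboolT//.
by rewrite partialsE.
Qed.

Lemma inner_sym p v w : inner g p v w = inner g p w v.
Proof.
rewrite /inner -[in LHS](trmxK (_ *m _ *m _)) [LHS]mxE !trmx_mul trmxK mulmxA.
by rewrite (gmx_sym g (chart_at_atlas S p) (chart_at_dom S p)).
Qed.

Lemma inner_ge0 p v : 0 <= inner g p v v.
Proof.
have [->|v0] := eqVneq v 0; first by rewrite /inner !mul0mx mxE.
by apply/ltW/(gmx_pos g (chart_at_atlas S p) (chart_at_dom S p)).
Qed.

Lemma innerDl p u v w : inner g p (u + v) w = inner g p u w + inner g p v w.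
Proof. by rewrite /inner !mulmxDl mxE. Qed.

Lemma innerZl p a v w : inner g p (a *: v) w = a * inner g p v w.
Proof. by rewrite /inner -!scalemxAl mxE. Qed.

Lemma innerZr p a v w : inner g p v (a *: w) = a * inner g p v w.
Proof. by rewrite inner_sym innerZl inner_sym. Qed.

Lemma innerDr p u v w : inner g p u (v + w) = inner g p u v + inner g p u w.
Proof. by rewrite inner_sym innerDl !(inner_sym p u). Qed.

Lemma tnorm_ge0 p v : 0 <= tnorm g p v.
Proof. exact: sqrtr_ge0. Qed.

Lemma sqr_tnorm p v : tnorm g p v ^+ 2 = inner g p v v.
Proof. by rewrite sqr_sqrtr// inner_ge0. Qed.

Lemma tnormZ p a v : tnorm g p (a *: v) = `|a| * tnorm g p v.
Proof.
by rewrite /tnorm innerZl innerZr mulrA -expr2 sqrtrM ?sqr_ge0// sqrtr_sqr.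
Qed.

(** With a = <v,v>, b = <v,w>, c = <w,w>, the squared norm of c v - b w equals c (a c - b^2) and is
    nonnegative. If c = 0, then w = 0 by definiteness. *)
Lemma inner_CauchySchwarz p v w :
  `|inner g p v w| <= tnorm g p v * tnorm g p w.
Proof.
rewrite -(@ler_pXn2r _ 2) ?nnegrE ?mulr_ge0 ?tnorm_ge0//.
rewrite real_normK ?num_real// exprMn !sqr_tnorm.
set a := inner g p v v; set b := inner g p v w; set c := inner g p w w.
have := inner_ge0 p (c *: v - b *: w).
rewrite -scaleNr innerDl !innerDr !innerZl !innerZr (inner_sym _ w v) -/a -/b -/c.
have : 0 <= c by exact: inner_ge0.
rewrite le_eqVlt => /predU1P[c0 _|c0 H].
  have w0 : w = 0.
    apply/eqP; apply: contraTT (lexx (0 : R)) => w0.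
    rewrite -ltNge {2}c0.
    exact: (gmx_pos g (chart_at_atlas S p) (chart_at_dom S p)).
  by rewrite /b w0 /inner trmx0 mulmx0 mxE expr0n/= -c0 mulr0.
rewrite -subr_ge0 -(pmulr_rge0 _ c0).
by apply: le_trans H _; rewrite le_eqVlt; apply/orP; left; apply/eqP; ring.
Qed.

Lemma inner_transition c p v : atlas S c -> dom c p ->
  inner g p (v *m 'J (chart_at S p \o param c) (c p))
            (v *m 'J (chart_at S p \o param c) (c p)) =
  (v *m gmx g c (c p) *m v^T) 0 0.
Proof.
move=> Sc cp; rewrite [in RHS](gmx_compat g Sc (chart_at_atlas S p) cp).
  by rewrite /inner trmx_mul !mulmxA.
exact: chart_at_dom.
Qed.

End Metric.

(** * Continuity of norms of gradients and velocities *)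

Section EntrywiseContinuity.
Context {R : realType} {T : topologicalType}.
Implicit Types (x : T).

Lemma sum_continuous_at (I : Type) (r : seq I) (P : pred I) (F : I -> T -> R) x :
  (forall i, {for x, continuous (F i)}) ->
  {for x, continuous (fun y => \sum_(i <- r | P i) F i y)}.
Proof.
by move=> Fc; apply: cvg_big => [|i _]; [exact: add_continuous|exact: Fc].
Qed.

Lemma prod_continuous_at (I : Type) (r : seq I) (P : pred I) (F : I -> T -> R) x :
  (forall i, {for x, continuous (F i)}) ->
  {for x, continuous (fun y => \prod_(i <- r | P i) F i y)}.
Proof.
by move=> Fc; apply: cvg_big => [|i _]; [exact: mul_continuous|exact: Fc].
Qed.

(** Stated entry by entry, so that products, determinants and inverses of matrices reduce to sums,
    products and quotients of real functions. *)
Definition mx_continuous_at m n (A : T -> 'M[R]_(m, n)) x :=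
  forall i j, {for x, continuous (fun y => A y i j)}.

Lemma det_continuous_at n (A : T -> 'M[R]_n) x :
  mx_continuous_at A x -> {for x, continuous (fun y => \det (A y))}.
Proof.
move=> Ac; apply: sum_continuous_at => s; apply: continuousM.
  exact: cst_continuous.
by apply: prod_continuous_at => i; exact: Ac.
Qed.

Lemma mulmx_continuous_at m n k (A : T -> 'M[R]_(m, n)) (B : T -> 'M[R]_(n, k)) x :
  mx_continuous_at A x -> mx_continuous_at B x ->
  mx_continuous_at (fun y => A y *m B y) x.
Proof.
move=> Ac Bc i j.
rewrite (_ : (fun y => _) = (fun y => \sum_l A y i l * B y l j)).
  by apply: sum_continuous_at => l; apply: continuousM; [exact: Ac|exact: Bc].
by apply/funext => y; rewrite mxE.
Qed.

Lemma trmx_continuous_at m n (A : T -> 'M[R]_(m, n)) x :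
  mx_continuous_at A x -> mx_continuous_at (fun y => (A y)^T) x.
Proof.
move=> Ac i j; rewrite (_ : (fun y => _) = (fun y => A y j i)); first exact: Ac.
by apply/funext => y; rewrite mxE.
Qed.

Lemma invmx_continuous_at n (A : T -> 'M[R]_n) x :
  A x \in unitmx -> mx_continuous_at A x ->
  mx_continuous_at (fun y => invmx (A y)) x.
Proof.
move=> ux Ac i j.
have detc := det_continuous_at Ac.
have detx : \det (A x) != 0 by rewrite -unitfE -unitmxE.
(* The determinant stays nonzero near x, and there the inverse is given by the cofactor formula. *)
apply: (@near_eq_continuous _ _
    (fun y => (\det (A y))^-1 * ((-1) ^+ (j + i) * \det (row' j (col' i (A y)))))).
  have : \forall y \near x, \det (A y) != 0.
    exact: (cvgr_neq0 _ detc detx).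
  by apply: filterS => y dy; rewrite /invmx unitmxE unitfE dy !mxE.
apply: continuousM; first exact: continuousV.
apply: continuousM; first exact: cst_continuous.
apply: det_continuous_at => k l.
rewrite (_ : (fun y => _) = (fun y => A y (lift j k) (lift i l))); first exact: Ac.
by apply/funext => y; rewrite !mxE.
Qed.

End EntrywiseContinuity.

Section MetricContinuity.
Context {R : realType} {n : nat} {M : topologicalType} {S : @smooth_structure R n M}.
Variable g : riemannian_metric S.
Implicit Types (c : @chart R n M) (p : M) (f : M -> R) (gam : R -> M).

Lemma gmx_continuous_at c x : atlas S c -> (c @` dom c) x ->
  mx_continuous_at (gmx g c) x.
Proof.
move=> Sc cx i j; apply: mx_entry_continuous.
exact: (smooth_on_continuous (gmx_smooth g Sc) cx).
Qed.

Lemma grad_sqnorm_continuous f c x : smooth_fun S f -> atlas S c ->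
  (c @` dom c) x -> {for x, continuous (grad_sqnorm g f c)}.
Proof.
move=> Sf Sc cx.
have Pc : mx_continuous_at (chart_partials f c) x.
  move=> i j.
  rewrite (_ : (fun y => _) = 'D_(delta_mx 0 j) (f \o param c)).
    exact: smooth_on_continuous_derive (Sf _ Sc) _ _ cx.
  by apply/funext => y; rewrite mxE.
apply: mulmx_continuous_at; last exact: trmx_continuous_at.
apply: mulmx_continuous_at => //; apply: invmx_continuous_at.
  by have [p cp <-] := cx; exact: gmx_unit.
exact: gmx_continuous_at.
Qed.

(** The chart chosen at q does not depend continuously on q. By [grad_sqnorm_transition] the value
    at every q near p may be computed in the single chart chosen at p. *)
Lemma sqr_tnorm_grad_continuous f : smooth_fun S f ->
  continuous (fun p => tnorm g p (grad g f p) ^+ 2).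
Proof.
move=> Sf p; set c := chart_at S p.
have cp : dom c p by exact: chart_at_dom.
have Sc : atlas S c by exact: chart_at_atlas.
apply: (@near_eq_continuous _ _ (grad_sqnorm g f c \o c)).
  have := nbhs_dom cp; apply: filterS => q cq; have Sq := chart_at_atlas S q.
  have dq := chart_at_dom S q.
  rewrite sqr_tnorm inner_grad_self; last first.
    exact: (smooth_fun_differentiable Sf Sq dq).
  by apply: grad_sqnorm_transition => //; apply: (smooth_fun_differentiable Sf).
apply: continuous_comp; first exact: Defs.coord_continuous.
by apply: grad_sqnorm_continuous => //; exists p.
Qed.

Lemma velocity_transition gam t c : {for t, continuous gam} ->
  atlas S c -> dom c (gam t) -> derivable (c \o gam) t 1 ->
  velocity (S:=S) gam t =
  derive1 (c \o gam) t *m 'J (chart_at S (gam t) \o param c) (c (gam t)).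
Proof.
move=> gc Sc ct dct; rewrite /velocity !derive1E.
set c' := chart_at S (gam t).
have c't : dom c' (gam t) by exact: chart_at_dom.
have dT := transition_differentiable Sc (chart_at_atlas S (gam t)) ct c't.
have E : \forall s \near t, (c' \o gam) s = ((c' \o param c) \o (c \o gam)) s.
  have := continuous_near gc (nbhs_dom ct).
  by apply: filterS => s cs /=; rewrite coordK.
rewrite (near_eq_derive _ E).
have dcg : differentiable (c \o gam) t by exact/derivable1_diffP.
rewrite deriveE; last exact: differentiable_comp.
rewrite diff_comp//= -deriveEjacobian// [RHS]deriveE//.
by rewrite [in RHS]deriveE.
Qed.

Lemma sqr_tnorm_velocity gam t c : {for t, continuous gam} ->
  atlas S c -> dom c (gam t) -> derivable (c \o gam) t 1 ->
  tnorm g (gam t) (velocity (S:=S) gam t) ^+ 2 =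
  (derive1 (c \o gam) t *m gmx g c (c (gam t)) *m (derive1 (c \o gam) t)^T) 0 0.
Proof.
move=> gc Sc ct dct.
by rewrite sqr_tnorm (velocity_transition gc Sc ct dct) inner_transition.
Qed.

Definition speed gam t : R := tnorm g (gam t) (velocity (S:=S) gam t).

Lemma speed_continuous gam t : C1_curve (S:=S) gam -> 0 <= t <= 1 ->
  {for t, continuous (speed gam)}.
Proof.
move=> C1 t01; have [gc C1t] := C1 t t01.
set c := chart_at S (gam t).
have ct : dom c (gam t) by exact: chart_at_dom.
have Sc : atlas S c by exact: chart_at_atlas.
have [dct cdct] := C1t c Sc ct.
have gct : \forall s \near t, dom c (gam s).
  exact: continuous_near gc (nbhs_dom ct).
pose v := derive1 (c \o gam).
apply: (@near_eq_continuous _ _ (fun s => Num.sqrt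
    ((v s *m gmx g c (c (gam s)) *m (v s)^T) 0 0))).
  have := nbhs_interior gct; apply: filterS2 dct => s dcs cs.
  have css := nbhs_singleton cs.
  (* [C1_curve] gives continuity of gam only at parameters in [0, 1], and s may lie just outside. It
     is recovered from the derivability of c o gam by composing with [param c]. *)
  have gs : {for s, continuous gam}.
    apply: (@near_eq_continuous _ _ (param c \o (c \o gam))).
      by apply: filterS cs => r cr /=; rewrite coordK.
    apply: continuous_comp.
      exact/differentiable_continuous/derivable1_diffP.
    by apply: param_continuous; exists (gam s).
  by rewrite -sqr_tnorm_velocity// sqrtr_sqr ger0_norm// tnorm_ge0.
have vc : mx_continuous_at v t by move=> i j; exact: mx_entry_continuous.
apply: (@continuous_comp _ _ _ _ (@Num.sqrt R)); last exact: sqrt_continuous.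
apply: mulmx_continuous_at; last exact: trmx_continuous_at.
apply: mulmx_continuous_at => // i j.
apply: (@continuous_comp _ _ _ (c \o gam) (fun x => gmx g c x i j)).
  by apply: continuous_comp => //; exact: Defs.coord_continuous.
by apply: gmx_continuous_at => //; exists (gam t).
Qed.

Lemma is_derive_smooth_curve f gam (t : R) : smooth_fun S f -> C1_curve (S:=S) gam ->
  0 <= t <= 1 ->
  is_derive t 1 (f \o gam)
    (inner g (gam t) (grad g f (gam t)) (velocity (S:=S) gam t)).
Proof.
move=> Sf C1 t01; have [gc C1t] := C1 t t01.
set c := chart_at S (gam t).
have ct : dom c (gam t) by exact: chart_at_dom.
have Sc : atlas S c by exact: chart_at_atlas.
have [dct _] := C1t c Sc ct.
have df := smooth_fun_differentiable Sf Sc ct.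
have dcg : differentiable (c \o gam) t.
  by apply/derivable1_diffP; exact: nbhs_singleton dct.
rewrite inner_grad//.
apply: (@near_eq_is_derive _ _ _ ((f \o param c) \o (c \o gam))).
  have := continuous_near gc (nbhs_dom ct).
  by apply: filterS => s cs /=; rewrite coordK.
have dfcg : differentiable ((f \o param c) \o (c \o gam)) t.
  exact: differentiable_comp.
split; first exact: diff_derivable.
by rewrite deriveE// diff_comp//= /velocity derive1E [in RHS]deriveE.
Qed.

End MetricContinuity.

(** * Lipschitz functions for the Riemannian distance *)

Section Variation.
Context {R : realType}.
Implicit Types (f s : R -> R).

(** Let x be the supremum of the t with f t <= f 0. Comparison on the left of x shows that x itself
    belongs to this set; if x < 1, comparison on the right produces a larger member. *)
Lemma locally_nonincreasing_le f :
  (forall t : R, 0 <= t <= 1 -> \forall r \near t, 0 <= r <= 1 ->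
    (t <= r -> f r <= f t) /\ (r <= t -> f t <= f r)) ->
  f 1 <= f 0.
Proof.
move=> H; pose A := [set t : R | 0 <= t <= 1 /\ f t <= f 0].
have A0 : A 0 by split; rewrite ?lexx ?ler01.
have hA : has_sup A.
  by split; [exists 0|exists 1 => t [/andP[]]].
pose x := sup A.
have Ax t : A t -> t <= x by move=> At; exact: (ub_le_sup hA.2).
have x01 : 0 <= x <= 1.
  by rewrite Ax//= ge_sup//; [exists 0|move=> t [/andP[]]].
have /nbhs_ballP[d /= d0 dH] := H x x01.
have fx : f x <= f 0.
  have [t At xt] := sup_adherent d0 hA.
  have [t01 ft] := At; apply: le_trans ft.
  have xdt : ball x d t.
    by rewrite /ball/= ger0_norm ?subr_ge0 ?Ax// ltrBlDl -ltrBlDr.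
  by have [_] := dH t xdt t01; apply; exact: Ax.
have /andP[x0 x1] := x01.
move: x1; rewrite le_eqVlt => /predU1P[<-//|x1].
pose r := Num.min 1 (x + d / 2).
have xr : x < r by rewrite lt_min x1 ltrDl divr_gt0.
have r01 : 0 <= r <= 1 by rewrite (le_trans x0 (ltW xr))/= ge_min lexx.
have xdr : ball x d r.
  rewrite /ball/= distrC gtr0_norm ?subr_gt0// ltrBlDl.
  rewrite (@le_lt_trans _ _ (x + d / 2)) ?ge_min ?lexx ?orbT// ltrD2l.
  by rewrite gtr_pMr// invf_lt1// ltr1n.
have [/(_ (ltW xr)) frx _] := dH r xdr r01.
by have := Ax r (conj r01 (le_trans frx fx)); rewrite leNgt xr.
Qed.

Lemma antiderivative_on_unit_segment s :
  (forall t : R, 0 <= t <= 1 -> {for t, continuous s}) ->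
  exists2 F : R -> R,
    forall t : R, 0 <= t <= 1 -> is_derive t 1 F (s t) &
    (\int[lebesgue_measure]_(t in `[0%R, 1%R]) (s t)%:E)%E = (F 1 - F 0)%:E.
Proof.
(* Precomposing with the retraction of the line onto [0, 1] extends s continuously to the whole
   line. *)
move=> sc; pose clamp (t : R) := Num.max 0 (Num.min 1 t).
have clamp01 t : 0 <= clamp t <= 1.
  by rewrite le_max lexx/= ge_max ler01 ge_min lexx.
have clampid t : 0 <= t <= 1 -> clamp t = t.
  by move=> /andP[t0 t1]; rewrite /clamp min_r// max_r.
pose s' := s \o clamp.
have s'c : continuous s'.
  move=> t; apply: continuous_comp; last exact: sc.
  apply: continuous_max; first exact: cst_continuous.
  by apply: continuous_min; [exact: cst_continuous|exact: id].
(* Starting at -1 makes 0 and 1 interior points of [-1, 2], so that F has two-sided derivatives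
   there. *)
pose F (x : R) : R := (\int[lebesgue_measure]_(t in `[-1, x]) s' t)%R.
have dF (t : R) : 0 <= t <= 1 -> is_derive t 1 F (s t).
  move=> /[dup] t01 /andP[t0 t1].
  have [|||| ? E] := @continuous_FTC1_closed R s' (-1) t 2.
  - by apply: le_lt_trans t1 _; rewrite ltr1n.
  - apply: continuous_compact_integrable; first exact: segment_compact.
    exact: continuous_subspaceT.
  - by apply: lt_le_trans t0; rewrite oppr_lt0.
  - exact: s'c.
  - by split => //; rewrite -derive1E E /s'/= clampid.
exists F => //.
have E01 t : t \in `[0%R, 1%R] -> s t = s' t.
  by rewrite in_itv/= => /clampid; rewrite /s'/= => ->.
rewrite (@eq_integral _ (measurableTypeR R) R lebesgue_measure `[0%R, 1%R]
  (fun t => (s' t)%:E)); last first.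
  by move=> t; rewrite inE => /E01 /= ->.
rewrite (@continuous_FTC2 _ s' F 0 1) ?EFinB ?ltr01//.
- exact: continuous_subspaceT.
- have cF (t : R) : 0 <= t <= 1 -> {for t, continuous F}.
    by move=> /dF[dFt _]; apply/differentiable_continuous/derivable1_diffP.
  split.
  + by move=> t /[!in_itv]/= /andP[t0 t1]; have [] := dF t; rewrite ?ltW.
  + by apply: cvg_at_right_filter; apply: cF; rewrite lexx ler01.
  + by apply: cvg_at_left_filter; apply: cF; rewrite lexx ler01.
- move=> t /[!in_itv]/= /andP[t0 t1].
  have t01 : 0 <= t <= 1 by rewrite !ltW.
  by have [_ dFt] := dF t t01; rewrite derive1E dFt /s'/= clampid.
Qed.

Lemma is_derive_near_le f (t a e : R) : is_derive t 1 f a -> 0 < e ->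
  \forall r \near t, `|f r - f t - a * (r - t)| <= e * `|r - t|.
Proof.
move=> [df <-] e0.
have dft : differentiable f t by exact/derivable1_diffP.
have /(@eqaddoP R R R R) := diff_locally dft.
move=> /(_ e e0)/nbhs_ballP[d /= d0 dH].
apply/nbhs_ballP; exists d => //= r tr.
have := dH (r - t); rewrite /ball/= !fctE /= sub0r normrN distrC subrK.
rewrite opprD addrA -[r - t]mulr1 -['d f t _]/('d f t ((r - t) *: 1)) linearZ/=.
rewrite -deriveE// mulr1 [_ *: _]mulrC; apply.
exact: tr.
Qed.

Lemma curve_variation_le f s (K : R) : 0 <= K ->
  (forall t : R, 0 <= t <= 1 -> {for t, continuous s}) ->
  (forall t e : R, 0 <= t <= 1 -> 0 < e -> \forall r \near t, 0 <= r <= 1 ->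
    `|f r - f t| <= (K * s t + e) * `|r - t|) ->
  (`|f 1 - f 0|%:E <=
    K%:E * \int[lebesgue_measure]_(t in `[0%R, 1%R]) (s t)%:E)%E.
Proof.
move=> K0 sc fs; have [F dF ->] := antiderivative_on_unit_segment sc.
rewrite -EFinM lee_fin.
suff main h : (forall t e : R, 0 <= t <= 1 -> 0 < e ->
    \forall r \near t, 0 <= r <= 1 ->
    `|h r - h t| <= (K * s t + e) * `|r - t|) -> h 1 - h 0 <= K * (F 1 - F 0).
  rewrite ler_norml main// andbT.
  suff : (\- f) 1 - (\- f) 0 <= K * (F 1 - F 0) by rewrite /=; lra.
  apply: main => t e t01 e0; apply: filterS (fs t e t01 e0) => r /[apply].
  by rewrite /= -opprD normrN.
move: h => {f fs} f fs.
apply/ler_addgt0Pr => e e0.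
pose G t := f t - K * F t - e * t.
suff : G 1 <= G 0 by rewrite /G mulr1 mulr0; lra.
apply: locally_nonincreasing_le => t t01.
have e20 : 0 < e / 2 by rewrite divr_gt0.
(* Half of e absorbs the error on f, the other half K times the error on F; the + 1 allows K = 0. *)
pose e' := e / 2 / (K + 1).
have e'0 : 0 < e' by rewrite divr_gt0// ltr_wpDl.
have Ke' : K * e' <= e / 2.
  rewrite /e' mulrA ler_pdivrMr ?ltr_wpDl// [leLHS]mulrC.
  by rewrite ler_wpM2l ?lerDl// ltW.
have := is_derive_near_le (dF t t01) e'0.
have := fs t _ t01 e20; apply: filterS2 => r frt Frt r01.
have {}frt := frt r01.
have KF : K * `|F r - F t - s t * (r - t)| <= e / 2 * `|r - t|.
  by apply: le_trans (ler_wpM2l K0 Frt) _; rewrite mulrA ler_wpM2r.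
rewrite -[X in X * _](ger0_norm K0) -normrM in KF.
split=> rt; move: frt KF.
- rewrite (ger0_norm (_ : 0 <= r - t)) ?subr_ge0// !ler_norml.
  by move=> /andP[? ?] /andP[? ?]; rewrite /G; lra.
- rewrite (ler0_norm (_ : r - t <= 0)) ?subr_le0// !ler_norml.
  by move=> /andP[? ?] /andP[? ?]; rewrite /G; lra.
Qed.

End Variation.

(* [integral] is built from suprema over simple functions, so that it is
   monotone with no measurability or integrability assumption. *)
Lemma integral_mono d (T : measurableType d) (R : realType)
    (mu : {measure set T -> \bar R}) (D : set T) (f h : T -> \bar R) :
  (forall x, D x -> (f x <= h x)%E) ->
  (\int[mu]_(x in D) f x <= \int[mu]_(x in D) h x)%E.
Proof.
move=> fh; rewrite /integral.
have fhD x : ((f \_ D) x <= (h \_ D) x)%E.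
  by rewrite /patch; case: ifPn => // /set_mem; exact: fh.
by apply: leeB; apply: le_ereal_sup => _ [k kf <-]; exists k => // x;
  apply: le_trans (kf x) _; rewrite ?funeposE ?funenegE ge_max !le_max lexx orbT
  andbT ?leeN2 fhD.
Qed.

(** * Lengths of curves and Lipschitz bounds *)

Section Distance.
Context {R : realType} {n : nat} {M : topologicalType} {S : @smooth_structure R n M}.
Variable g : riemannian_metric S.
Implicit Types (c : @chart R n M) (p : M) (f : M -> R) (gam : R -> M).

Lemma path_length_ge0 p q l : piecewise_C1_path g p q l -> (0 <= l)%E.
Proof.
elim=> // gam l' _ l'0 _; apply: adde_ge0 => //.
by apply: integral_ge0 => t _; rewrite lee_fin tnorm_ge0.
Qed.

Lemma rdist_ge0 p q : (0 <= rdist g p q)%E.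
Proof. by apply: le_ereal_inf_tmp => l /path_length_ge0. Qed.

Lemma rdist_le_speed gam (B : R) : C1_curve (S:=S) gam ->
  (forall t : R, 0 <= t <= 1 -> speed g gam t <= B) ->
  (rdist g (gam 0%R) (gam 1%R) <= B%:E)%E.
Proof.
move=> C1 sB; apply: (@le_trans _ _ (0 + curve_length g gam)%E).
  by apply: ereal_inf_lbound; apply: path_rcons => //; exact: path_nil.
rewrite add0e; apply: (@le_trans _ _
  (\int[lebesgue_measure]_(t in `[0%R, 1%R]) (cst B%:E t))%E).
  apply: integral_mono => t /=; rewrite in_itv/= => t01.
  by rewrite lee_fin; exact: sB.
by rewrite integral_cst//= lebesgue_measure_itv/= lte_fin ltr01 -EFinB subr0 mule1.
Qed.

Section Subcurve.
Variables (gam : R -> M) (a b : R).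
Hypotheses (C1 : C1_curve (S:=S) gam) (a01 : 0 <= a <= 1) (b01 : 0 <= b <= 1).

(** The arc from gam a to gam b, reparametrized by [0, 1]; for b < a it is run backwards. *)
Definition subcurve (t : R) : M := gam (a + t * (b - a)).

Let aff01 (t : R) : 0 <= t <= 1 -> 0 <= a + t * (b - a) <= 1.
Proof.
move: a01 b01 => /andP[a0 a1] /andP[b0 b1] /andP[t0 t1].
have -> : a + t * (b - a) = (1 - t) * a + t * b by ring.
rewrite addr_ge0 ?mulr_ge0 ?subr_ge0//=.
apply: (@le_trans _ _ ((1 - t) * 1 + t * 1)); last by rewrite !mulr1 subrK.
by rewrite lerD// ler_wpM2l ?subr_ge0.
Qed.

Let dsub (h : R -> 'rV[R]_n) t : derivable h (a + t * (b - a)) 1 ->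
  is_derive t 1 (fun s => h (a + s * (b - a)))
    ((b - a) *: derive1 h (a + t * (b - a))).
Proof.
move=> dh.
have daff : is_derive t 1 (fun s : R => a + s * (b - a)) (b - a).
  by apply: is_derive_eq; rewrite scaler0 !add0r mul1r; exact: mulr1.
have dh' : differentiable h (a + t * (b - a)) by exact/derivable1_diffP.
have da' : differentiable (fun s : R => a + s * (b - a)) t.
  by apply/derivable1_diffP.
have dc := differentiable_comp da' dh'.
split; first by apply: diff_derivable dc.
rewrite (deriveE _ dc).
have /(congr1 (@^~ 1)) -> := diff_comp da' dh'.
rewrite /= -(deriveE _ da') derive_val derive1E (deriveE _ dh').
by rewrite -[X in 'd _ _ X]mulr1 [LHS]linearZ.
Qed.

Lemma subcurve_C1 : C1_curve (S:=S) subcurve.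
Proof.
move=> t t01; have [gc C1t] := C1 (aff01 t01).
have affc : {for t, continuous (fun s : R => a + s * (b - a))}.
  apply: continuousD; first exact: cst_continuous.
  by apply: continuousM; [exact: id|exact: cst_continuous].
split; first exact: (continuous_comp affc gc).
move=> c Sc ct; have [dct cdct] := C1t c Sc ct.
have dn := continuous_near affc dct.
split; first by apply: filterS dn => s /dsub[].
apply: (@near_eq_continuous R 'rV[R]_n
    (fun s => (b - a) *: derive1 (c \o gam) (a + s * (b - a)))).
  by apply: filterS dn => s /dsub[_ <-]; rewrite derive1E.
apply: continuousZr.
exact: (continuous_comp affc cdct).
Qed.

Lemma speed_subcurve (t : R) : 0 <= t <= 1 ->
  speed g subcurve t = `|b - a| * speed g gam (a + t * (b - a)).
Proof.
move=> t01; have [gc C1t] := C1 (aff01 t01).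
have [dct _] := C1t _ (chart_at_atlas S (subcurve t)) (chart_at_dom S _).
rewrite /speed -tnormZ; congr tnorm; rewrite /velocity derive1E.
by have [_] := dsub (nbhs_singleton dct).
Qed.

Lemma rdist_curve_le (B : R) :
  (forall t : R, 0 <= t <= 1 -> speed g gam (a + t * (b - a)) <= B) ->
  (rdist g (gam a) (gam b) <= (`|b - a| * B)%:E)%E.
Proof.
move=> sB.
have <- : subcurve 0 = gam a by rewrite /subcurve mul0r addr0.
have <- : subcurve 1 = gam b by rewrite /subcurve mul1r addrC subrK.
apply: rdist_le_speed subcurve_C1 _ => t t01.
by rewrite speed_subcurve// ler_wpM2l// sB.
Qed.

End Subcurve.

(** The infinitesimal form of the K-Lipschitz condition, in the shape that [curve_variation_le]
    integrates. *)
Definition curvewise_lipschitz (K : R) f := forall gam, C1_curve (S:=S) gam ->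
  forall t e : R, 0 <= t <= 1 -> 0 < e -> \forall r \near t, 0 <= r <= 1 ->
    `|f (gam r) - f (gam t)| <= (K * speed g gam t + e) * `|r - t|.

(** Dividing by K > 0 reduces the infimum to one path at a time. Induction on its C^1 pieces then
    adds up the bounds of [curve_variation_le]. *)
Lemma curvewise_lipschitzP (K : R) f : 0 < K -> curvewise_lipschitz K f ->
  lipschitz_with g K setT f.
Proof.
move=> K0 fK p q _ _.
rewrite muleC -lee_pdivrMr//.
apply: le_ereal_inf_tmp => l pql; rewrite lee_pdivrMr// muleC.
elim: pql => [|gam l' pl' IH C1].
  by rewrite subrr normr0 mule0.
rewrite muleDr ?ge0_adde_def ?inE ?path_length_ge0//; last 2 first.
  exact: path_length_ge0 pl'.
  by apply: integral_ge0 => t _; rewrite lee_fin tnorm_ge0.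
apply: (@le_trans _ _ (`|f p - f (gam 0%R)|%:E + `|f (gam 1%R) - f (gam 0%R)|%:E)%E).
  by rewrite -EFinD lee_fin [X in _ <= _ + X]distrC ler_distD.
apply: leeD => //.
apply: (curve_variation_le (f := f \o gam)); first exact: ltW.
  by move=> t t01; exact: speed_continuous.
exact: fK.
Qed.

(** The derivative along a curve is <grad f, velocity>, which Cauchy-Schwarz bounds by K times the
    speed. *)
Lemma smooth_lipschitz (K : R) f : 0 < K -> smooth_fun S f ->
  (forall p, tnorm g p (grad g f p) <= K) -> lipschitz_with g K setT f.
Proof.
move=> K0 Sf fK; apply: curvewise_lipschitzP => // gam C1 t e t01 e0.
have := is_derive_near_le (is_derive_smooth_curve g Sf C1 t01) e0.
apply: filterS => r /= H _.
have : `|inner g (gam t) (grad g f (gam t)) (velocity (S:=S) gam t) * (r - t)|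
    <= K * speed g gam t * `|r - t|.
  rewrite normrM ler_wpM2r// (le_trans (inner_CauchySchwarz _ _ _ _))//.
  by rewrite ler_wpM2r ?tnorm_ge0.
move=> H'; rewrite mulrDl [leRHS]addrC -[f _ - f _](subrK (inner g (gam t)
  (grad g f (gam t)) (velocity (S:=S) gam t) * (r - t))).
by rewrite (le_trans (ler_normD _ _))// lerD.
Qed.

End Distance.

(** * Coordinate segments and locally Lipschitz functions *)

Section LinesInCharts.
Context {R : realType} {n : nat} {M : topologicalType} {S : @smooth_structure R n M}.
Variable g : riemannian_metric S.
Implicit Types (c : @chart R n M) (p : M) (f : M -> R).

Section Line.
Variables (c : @chart R n M) (x h : 'rV[R]_n).
Hypotheses (Sc : atlas S c)
  (seg : forall t : R, 0 <= t <= 1 -> (c @` dom c) (x + t *: h)).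

Definition chart_line (t : R) : M := param c (x + t *: h).

Let line_continuous (t : R) : {for t, continuous (fun s : R => x + s *: h)}.
Proof.
apply: continuousD; first exact: cst_continuous.
by apply: continuousZl.
Qed.

Let dom_line (t : R) : 0 <= t <= 1 -> dom c (chart_line t).
Proof. by move=> /seg[p cp px]; rewrite /chart_line -px coordK. Qed.

Let coord_line (t : R) : 0 <= t <= 1 -> c (chart_line t) = x + t *: h.
Proof. by move=> /seg[p cp px]; rewrite /chart_line -px coordK. Qed.

(** Seen in another chart, the curve is a smooth transition map restricted to a straight line. *)
Lemma chart_line_C1 : C1_curve (S:=S) chart_line.
Proof.
move=> t t01; split.
  apply: (continuous_comp (line_continuous (t := t))).
  by apply: param_continuous; exact: seg.
move=> c' Sc' c't.
pose U := c @` (dom c `&` dom c').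
have oU : open U by exact: open_chart_image (dom_open c').
have UT := transition_smooth Sc Sc'.
have Ut : U (x + t *: h).
  by exists (chart_line t); [split => //; exact: dom_line|exact: coord_line].
have nU := continuous_near (line_continuous (t := t)) (open_nbhs_nbhs (conj oU Ut)).
have dT (s : R) : U (x + s *: h) -> is_derive s 1 (c' \o chart_line)
    ('D_h (c' \o param c) (x + s *: h)).
  move=> Us; apply: (is_derive_line (f := c' \o param c)).
  exact: (smooth_on_derivable UT).
split; first by apply: filterS nU => s /dT[].
apply: (@near_eq_continuous R 'rV[R]_n
    (fun s => 'D_h (c' \o param c) (x + s *: h))).
  by apply: filterS nU => s /dT[_ <-]; rewrite derive1E.
apply: (@continuous_comp R 'rV[R]_n 'rV[R]_n (fun s : R => x + s *: h)
    ('D_h (c' \o param c))); first exact: line_continuous.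
exact: (smooth_on_continuous_derive UT _ h Ut).
Qed.

Lemma sqr_speed_chart_line (t : R) : 0 <= t <= 1 ->
  speed g chart_line t ^+ 2 = (h *m gmx g c (x + t *: h) *m h^T) 0 0.
Proof.
move=> t01; have [gc C1t] := chart_line_C1 t01.
have [dct _] := C1t c Sc (dom_line t01).
rewrite /speed (sqr_tnorm_velocity g gc Sc (dom_line t01) (nbhs_singleton dct)).
have -> : derive1 (c \o chart_line) t = h.
  have nU := continuous_near (line_continuous (t := t))
    (open_nbhs_nbhs (conj (@codom_open _ _ _ c) (seg t01))).
  rewrite derive1E.
  have E : \forall s \near t, (c \o chart_line) s = x + s *: h.
    by apply: filterS nU => s [p cp px]; rewrite /= /chart_line -px coordK.
  rewrite (near_eq_derive _ E).
  have := @is_derive_line R _ 'rV[R]_n id x h t (@derivable_id _ _ _ _).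
  by move=> [_ ->]; rewrite derive_id.
by rewrite coord_line.
Qed.

End Line.

(** The coordinate segment from p to q has direction c q - c p, which tends to 0 as q tends to p.
    Its squared speed is continuous in direction and base point and vanishes for direction 0, hence
    is small along the whole segment. *)
Lemma rdist_near p (e : R) : 0 < e -> \forall q \near p, (rdist g p q <= e%:E)%E.
Proof.
move=> e0; set c := chart_at S p.
have cp : dom c p by exact: chart_at_dom.
have Sc : atlas S c by exact: chart_at_atlas.
have cpc : (c @` dom c) (c p) by exists p.
(* The squared speed of the segment from [c p] in direction [z.1], at [z.2]. *)
pose Q (z : 'rV[R]_n * 'rV[R]_n) : R := (z.1 *m gmx g c z.2 *m z.1^T) 0 0.
have Qc : {for ((0 : 'rV[R]_n), c p), continuous Q}.
  have fstc : mx_continuous_at (@fst 'rV[R]_n 'rV[R]_n) (0, c p).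
    by move=> i j; apply: mx_entry_continuous; exact: cvg_fst.
  apply: mulmx_continuous_at; last exact: trmx_continuous_at.
  apply: mulmx_continuous_at => // i j.
  apply: (@continuous_comp _ _ _ (@snd 'rV[R]_n 'rV[R]_n) (fun y => gmx g c y i j)).
    exact: cvg_snd.
  exact: gmx_continuous_at.
have Q0 : Q (0, c p) = 0 by rewrite /Q /= !mul0mx mxE.
have : \forall z \near ((0 : 'rV[R]_n), c p), Q z < e ^+ 2.
  apply: (continuous_near (A := [set y | y < e ^+ 2]) Qc).
  by apply: open_nbhs_nbhs; split; [exact: open_lt|rewrite /= Q0 exprn_gt0].
move=> [[A B] /= [A0 Bp] AB].
have [r /= r0 rB] := (@nbhs_normP R 'rV[R]_n _ _).1
  (filterI Bp (open_nbhs_nbhs (conj (@codom_open _ _ _ c) cpc))).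
have [d /= d0 dA] := (@nbhs_normP R 'rV[R]_n _ _).1 A0.
have : \forall x \near c p, `|c p - x| < Num.min r d.
  apply: (@nbhs_normP R 'rV[R]_n _ _).2; exists (Num.min r d) => //=.
  by rewrite lt_min r0.
move=> /(chart_near_pullback cp); apply: filterS => q [cq].
rewrite lt_min => /andP[qr qd].
pose h := c q - c p.
have inB (t : R) : 0 <= t <= 1 -> B (c p + t *: h) /\ (c @` dom c) (c p + t *: h).
  move=> /andP[t0 t1]; apply: rB => /=; rewrite opprD addNKr normrN normrZ.
  by rewrite ger0_norm// (le_lt_trans _ qr)// distrC ler_piMl.
have seg (t : R) t01 := (inB t t01).2.
have <- : chart_line c (c p) h 0 = p by rewrite /chart_line scale0r addr0 coordK.
have <- : chart_line c (c p) h 1 = q.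
  by rewrite /chart_line scale1r /h addrC subrK coordK.
apply: rdist_le_speed; first exact: chart_line_C1.
move=> t t01.
rewrite -(@ler_pXn2r _ 2) ?nnegrE ?tnorm_ge0 ?(ltW e0)// sqr_speed_chart_line//.
apply: ltW; apply: (AB (h, c p + t *: h)); split => /=.
  by apply: dA; rewrite /= sub0r normrN distrC.
by have [] := inB t t01.
Qed.

(** The sign condition on K lets constants be multiplied and added even when the distance is
    infinite. *)
Definition lipschitz_near f p :=
  exists2 K : R, 0 <= K & exists2 U, nbhs p U & lipschitz_with g K U f.

Lemma locally_lipschitz_near f p : locally_lipschitz_fun g f -> lipschitz_near f p.
Proof.
move=> /(_ p)[K [U pU KU]]; exists `|K| => //; exists U => // a b Ua Ub.
by apply: le_trans (KU a b Ua Ub) _; rewrite lee_wpmul2r ?rdist_ge0// lee_fin ler_norm.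
Qed.

Lemma lipschitz_near_continuous f p : lipschitz_near f p -> {for p, continuous f}.
Proof.
move=> [K K0 [U pU KU]]; apply/cvgrPdist_le => e e0.
have e'0 : 0 < e / (K + 1) by rewrite divr_gt0// ltr_wpDl.
have Up := nbhs_singleton pU; have := rdist_near p e'0; apply: filterS2 pU => q Uq pq.
rewrite -lee_fin; apply: le_trans (KU p q Up Uq) _.
apply: le_trans (lee_wpmul2l _ pq) _; rewrite ?lee_fin//.
by rewrite mulrA ler_pdivrMr ?ltr_wpDl// [leLHS]mulrC ler_wpM2l ?lerDl// ltW.
Qed.

(** Here d stands for a distance, possibly +oo; distributing over it relies on nonnegative
    coefficients. *)
Lemma lipschitz_near_lin (K1 K2 A B x y z : R) (d : \bar R) :
  0 <= K1 -> 0 <= K2 -> 0 <= A -> 0 <= B -> (0 <= d)%E ->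
  x <= A * y + B * z -> (y%:E <= K1%:E * d)%E -> (z%:E <= K2%:E * d)%E ->
  (x%:E <= (A * K1 + B * K2)%:E * d)%E.
Proof.
move=> K10 K20 A0 B0 d0 xyz yd zd.
apply: (@le_trans _ _ ((A * y + B * z)%:E)); first by rewrite lee_fin.
rewrite !EFinD ge0_muleDl ?lee_fin ?mulr_ge0// !EFinM -!muleA.
by apply: leeD; apply: lee_wpmul2l; rewrite ?lee_fin.
Qed.

Lemma lipschitz_nearM f h p : lipschitz_near f p -> lipschitz_near h p ->
  lipschitz_near (fun q => f q * h q) p.
Proof.
move=> fp hp; have fc := lipschitz_near_continuous fp.
have hc := lipschitz_near_continuous hp.
have bounded_near (k : M -> R) : {for p, continuous k} ->
    \forall q \near p, `|k q| <= `|k p| + 1.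
  move=> /cvgrPdist_le/(_ _ ltr01); apply: filterS => q kq.
  rewrite -(subrK (k p) (k q)) addrC (le_trans (ler_normD _ _))//.
  by rewrite lerD2l// distrC.
have [K1 K10 [U pU KU]] := fp; have [K2 K20 [V pV KV]] := hp.
exists ((`|h p| + 1) * K1 + (`|f p| + 1) * K2).
  by rewrite addr_ge0 ?mulr_ge0 ?addr_ge0.
exists ((U `&` V) `&` ([set q | `|f q| <= `|f p| + 1] `&`
    [set q | `|h q| <= `|h p| + 1])).
  by apply: filterI; apply: filterI => //; exact: bounded_near.
move=> a b [[Ua Va] [fa ha]] [[Ub Vb] [fb hb]].
apply: lipschitz_near_lin (KU a b Ua Ub) (KV a b Va Vb) => //;
  rewrite ?addr_ge0 ?rdist_ge0//.
rewrite (_ : f a * h a - f b * h b =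
  h a * (f a - f b) + f b * (h a - h b)); last by ring.
rewrite (le_trans (ler_normD _ _))// !normrM.
by rewrite lerD// ler_wpM2r.
Qed.

Lemma lipschitz_near_comp (F dF : R -> R) f p : lipschitz_near f p ->
  (\forall x \near f p, is_derive (x : R) 1 F (dF x)) -> {for f p, continuous dF} ->
  lipschitz_near (F \o f) p.
Proof.
move=> fp dFx dFc; have fc := lipschitz_near_continuous fp.
have [K K0 [U pU KU]] := fp.
have : \forall x \near f p, is_derive (x : R) 1 F (dF x) /\
    `|dF x| <= `|dF (f p)| + 1.
  apply: filterI => //; move/cvgrPdist_le : dFc => /(_ _ ltr01).
  apply: filterS => x kx.
  rewrite -(subrK (dF (f p)) (dF x)) addrC (le_trans (ler_normD _ _))//.
  by rewrite lerD2l// distrC.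
move=> /nbhs_normP[d /= d0 dH].
(* A mean value point lies within |f a - f b| < 2d/3 of f b, which is within d/3 of f p. It
   therefore stays in the ball of radius d. *)
have : \forall q \near p, `|f p - f q| < d / 3.
  by move/cvgrPdist_lt : fc; apply; rewrite divr_gt0.
(* The zero summand only matches the two-term shape of [lipschitz_near_lin]. *)
move=> pd; exists ((`|dF (f p)| + 1) * K + 0 * K).
  by rewrite addr_ge0 ?mulr_ge0 ?addr_ge0.
exists (U `&` [set q | `|f p - f q| < d / 3]); first exact: filterI.
move=> a b [Ua /= fa] [Ub /= fb].
apply: lipschitz_near_lin (KU a b Ua Ub) (KU a b Ua Ub) => //;
  rewrite ?addr_ge0 ?rdist_ge0// mul0r addr0.
have near_b x : `|x - f b| <= `|f a - f b| -> ball_ Num.norm (f p) d x.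
  move=> xb /=; apply: le_lt_trans (ler_distD (f b) _ _) _.
  rewrite [X in _ + X]distrC.
  have : `|f a - f b| < d / 3 + d / 3.
    by apply: le_lt_trans (ler_distD (f p) _ _) _; rewrite distrC ltrD.
  by move: xb fb; lra.
have [x /near_b/dH[//]|x /near_b/dH[_ dFx'] /= ->] := @MVT_sym R F dF (f b) (f a).
by rewrite normrM ler_wpM2r.
Qed.

Lemma lipschitz_near_cst_near f p (k : R) : (\forall q \near p, f q = k) ->
  lipschitz_near f p.
Proof.
move=> fk; exists 0 => //; exists [set q | f q = k] => // a b /= -> ->.
by rewrite subrr normr0 mul0e.
Qed.

Lemma lipschitz_fun_near f p : lipschitz_fun g f -> lipschitz_near f p.
Proof.
move=> [K KT]; exists `|K| => //; exists setT; first exact: filterT.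
move=> a b _ _; apply: le_trans (KT a b I I) _.
by rewrite lee_wpmul2r ?rdist_ge0// lee_fin ler_norm.
Qed.

(** Compactness yields one constant L valid around every point of the support, and off the support f
    vanishes locally. Along a curve, the distance between nearby points is at most that of the arc
    joining them, which gives the infinitesimal bound with constant L. *)
Lemma compactly_supported_lipschitz f : (forall p, lipschitz_near f p) ->
  compact (closure [set p | f p != 0]) -> lipschitz_fun g f.
Proof.
move=> fl cK; set A := closure _ in cK.
(* Only comparisons with the centre p are recorded, which is all that [curvewise_lipschitz] asks
   for. *)
pose P (L : R) p :=
  \forall q \near p, (`|f p - f q|%:E <= L%:E * rdist g p q)%E.
have : \forall L \near +oo, A `<=` P L.
  apply: (compact_near_coveringP A).1 cK _ _ _ _ _ => p _.
  have [K K0 [U pU KU]] := fl p.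
  exists (U^°, [set L | K < L]) => /=.
    by split; [exact: nbhs_interior|exact: nbhs_pinfty_gt (num_real K)].
  move=> [q L] /= [qU KL]; have Uq := nbhs_singleton qU.
  apply: filterS qU => r Ur; apply: le_trans (KU q r Uq Ur) _.
  by rewrite lee_wpmul2r ?rdist_ge0// lee_fin ltW.
move=> /(filterI (nbhs_pinfty_gt (num_real (0 : R))))/filter_ex[L /= [L0 AL]].
exists L; apply: curvewise_lipschitzP => // gam C1 t e t01 e0.
have PL p : P L p.
  have [/AL//|nAp] := pselect (A p).
  have : \forall q \near p, f q = 0.
    have : nbhs p (~` A).
      apply: open_nbhs_nbhs; split => //.
      by apply: closed_openC; exact: closed_closure.
    apply: filterS => q nAq; apply/eqP; apply: contraPT nAq => fq.
    by apply; exact: subset_closure.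
  move=> fq0; have fp0 := nbhs_singleton fq0.
  apply: filterS fq0 => q ->; rewrite fp0 subrr normr0.
  by rewrite mule_ge0 ?rdist_ge0 ?lee_fin ?ltW.
have [gc _] := C1 t t01.
(* Near t the speed exceeds its value at t by less than e / L, which becomes e after multiplication
   by L. *)
have e'0 : 0 < e / L by rewrite divr_gt0.
have : \forall s \near t, speed g gam s < speed g gam t + e / L.
  have sc := speed_continuous (g := g) C1 t01.
  apply: (continuous_near (A := [set y | y < speed g gam t + e / L]) sc).
  by apply: open_nbhs_nbhs; split; [exact: open_lt|rewrite /= ltrDl].
move=> /nbhs_ballP[d /= d0 dH].
have tb : nbhs t (ball t d) by exact: nbhsx_ballx.
have := continuous_near gc (PL (gam t)); apply: filterS2 tb => r tr Pr r01.
rewrite distrC -lee_fin; apply: le_trans Pr _.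
have -> : ((L * speed g gam t + e) * `|r - t|)%:E =
    (L%:E * (`|r - t| * (speed g gam t + e / L))%:E)%E.
  by rewrite -EFinM; congr (_%:E); field; rewrite gt_eqF.
apply: lee_wpmul2l; first by rewrite lee_fin ltW.
apply: rdist_curve_le => // s /andP[s0 s1]; apply/ltW/dH.
rewrite /ball/= opprD addNKr normrN normrM ger0_norm// (le_lt_trans _ tr)//.
by rewrite distrC ler_piMl.
Qed.

End LinesInCharts.

(** * Integration *)

Section AlmostEverywhereComparison.
Context d (T : measurableType d) (R : realType).
Variable mu : {measure set T -> \bar R}.
Implicit Types (f h : T -> \bar R).

(* An infinite value on the exceptional null set makes an almost everywhere
   bound hold everywhere, so that one of the two sides need not be measurable. *)
Let ae_eq_ifT f (v : \bar R) (N : set T) : measurable N -> mu N = 0%E ->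
  measurable_fun setT f ->
  (\int[mu]_x (if x \in N then v else f x) = \int[mu]_x f x)%E.
Proof.
move=> mN N0 mf; apply: ae_eq_integral => //.
  apply: measurable_fun_ifT => //; apply: (measurable_fun_bool true) => /=.
  rewrite setTI (_ : _ @^-1` _ = N)//.
  by apply/seteqP; split => x /=; [move=> /set_mem|move=> /mem_set].
exists N; split => // x /= H; apply: contrapT => nN.
by apply: H => _; rewrite memNset.
Qed.

Lemma ae_le_integral_r f h : measurable_fun setT h ->
  {ae mu, forall x, (f x <= h x)%E} -> (\int[mu]_x f x <= \int[mu]_x h x)%E.
Proof.
move=> mh [N [mN N0 fhN]]; rewrite -(ae_eq_ifT +oo%E mN N0 mh).
apply: integral_mono => x _; case: ifPn => [_|]; first exact: leey.
by move=> /negP xN; apply: contrapT => H; apply/xN/mem_set/fhN.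
Qed.

Lemma ae_le_integral_l f h : measurable_fun setT f ->
  {ae mu, forall x, (f x <= h x)%E} -> (\int[mu]_x f x <= \int[mu]_x h x)%E.
Proof.
move=> mf [N [mN N0 fhN]]; rewrite -(ae_eq_ifT -oo%E mN N0 mf).
apply: integral_mono => x _; case: ifPn => [_|]; first exact: leNye.
by move=> /negP xN; apply: contrapT => H; apply/xN/mem_set/fhN.
Qed.

End AlmostEverywhereComparison.

(** * From the pointwise bound to the integral inequality *)

Section HardyAlgebra.
Context d (T : measurableType d) (R : realType).
Variable mu : {measure set T -> \bar R}.
Variables (A J F : T -> R).
Hypotheses (iA : mu.-integrable setT (EFin \o A)) (mJ : measurable_fun setT J).
Hypothesis J0 : forall x, 0 <= J x.

Let lincomb (c e : R) : mu.-integrable setT (EFin \o J) ->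
  mu.-integrable setT (EFin \o (fun x => c * A x + e * J x)) /\
  (\int[mu]_x (c * A x + e * J x)%:E =
   c%:E * \int[mu]_x (A x)%:E + e%:E * \int[mu]_x (J x)%:E)%E.
Proof.
move=> iJ; have iA' := integrableZl measurableT c iA.
have iJ' := integrableZl measurableT e iJ.
split; first by apply: eq_integrable (integrableD measurableT iA' iJ').
rewrite -!integralZl// -integralD//.
Qed.

Let J_integrable : (\int[mu]_x (J x)%:E < +oo)%E -> mu.-integrable setT (EFin \o J).
Proof.
move=> Joo; apply/integrableP; split; first exact/measurable_EFinP.
by under eq_integral do rewrite /= ger0_norm//.
Qed.

Let concl (b I j : R) : 0 < b -> b / 2 * I <= 2 / b * j -> (b / 2) ^+ 2 * I <= j.
Proof.
move=> b0 H; rewrite -(@ler_pM2l _ (2 / b)) ?divr_gt0//; apply: le_trans H.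
by rewrite mulrA le_eqVlt; apply/orP; left; apply/eqP; field; rewrite gt_eqF.
Qed.

(** A and J are the two integrands of the inequality and F is the Laplacian pairing. With b = 1 - a
    - C, integrating the bound on F leaves (b - b/2) times the integral of A below 2/b times that of
    J; multiplying by b/2 gives the constant (b/2)^2. *)
Lemma hardy_of_laplacian_le (a C : R) : 0 < 1 - a - C ->
  {ae mu, forall x, F x <=
    (a - 1 + (1 - a - C) / 2) * A x + 2 / (1 - a - C) * J x} ->
  (- (\int[mu]_x (F x)%:E) <= C%:E * \int[mu]_x (A x)%:E)%E ->
  ((((1 - a - C) / 2) ^+ 2)%:E * \int[mu]_x (A x)%:E <= \int[mu]_x (J x)%:E)%E.
Proof.
set b := 1 - a - C => b0 FG FC.
(* An infinite right-hand side is trivial; otherwise J is integrable and the integrals of A and J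
   are real numbers. *)
have [Joo|] := ltP (\int[mu]_x (J x)%:E)%E +oo%E; last first.
  by rewrite leye_eq => /eqP ->; exact: leey.
have iJ := J_integrable Joo.
have [iG EG] := lincomb (a - 1 + b / 2) (2 / b) iJ.
have FG' : {ae mu, forall x,
    ((F x)%:E <= ((a - 1 + b / 2) * A x + 2 / b * J x)%:E)%E}.
  by apply: filterS FG => x; rewrite lee_fin.
have := ae_le_integral_r (measurable_int _ iG) FG'.
rewrite [in X in (_ <= X)%E -> _]EG -leeN2 => /le_trans/(_ FC).
have /fineK <- := integrable_fin_num measurableT iA.
have /fineK <- := integrable_fin_num measurableT iJ.
rewrite -!EFinM -EFinD -EFinN !lee_fin => H; apply: concl => //.
have bE : b = 1 - a - C by [].
by move: H; rewrite mulrDl opprD; move: (fine _) (fine _) => I j; nra.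
Qed.

Lemma hardy_of_laplacian_ge (a C : R) : 0 < a + C - 1 ->
  {ae mu, forall x,
    (a - 1 - (a + C - 1) / 2) * A x - 2 / (a + C - 1) * J x <= F x} ->
  (C%:E * \int[mu]_x (A x)%:E <= - (\int[mu]_x (F x)%:E))%E ->
  ((((a + C - 1) / 2) ^+ 2)%:E * \int[mu]_x (A x)%:E <= \int[mu]_x (J x)%:E)%E.
Proof.
set b := a + C - 1 => b0 FG FC.
have [Joo|] := ltP (\int[mu]_x (J x)%:E)%E +oo%E; last first.
  by rewrite leye_eq => /eqP ->; exact: leey.
have iJ := J_integrable Joo.
have [iG EG] := lincomb (a - 1 - b / 2) (- (2 / b)) iJ.
have GF : {ae mu, forall x,
    (((a - 1 - b / 2) * A x + - (2 / b) * J x)%:E <= (F x)%:E)%E}.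
  by apply: filterS FG => x; rewrite mulNr lee_fin.
have := ae_le_integral_l (measurable_int _ iG) GF.
rewrite [in X in (X <= _)%E -> _]EG -leeN2 => /(le_trans FC).
have /fineK <- := integrable_fin_num measurableT iA.
have /fineK <- := integrable_fin_num measurableT iJ.
rewrite -!EFinM -EFinD -EFinN !lee_fin => H; apply: concl => //.
have bE : b = a + C - 1 by [].
by move: H; move: (fine _) (fine _) => I j; rewrite mulNr opprD opprK -lerBlDl; nra.
Qed.

End HardyAlgebra.

(** * Borel sets and finiteness of the volume on compact sets *)

Lemma open_borel (T : ptopologicalType) (A : set T) : open A ->
  measurable (A : set (borel T)).
Proof. by move=> oA; exact: sub_sigma_algebra. Qed.

Lemma closed_borel (T : ptopologicalType) (A : set T) : closed A ->
  measurable (A : set (borel T)).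
Proof.
move=> cA; rewrite -(setCK A); apply: measurableC; apply: open_borel.
exact: closed_openC.
Qed.

Lemma continuous_borel (T : ptopologicalType) (R : realType) (f : T -> R) :
  continuous f -> measurable_fun (setT : set (borel T)) f.
Proof.
move=> /continuousP cf; apply: (measurability _ (RGenOpens.measurableE R)).
move=> _ [_ [a [b ->] <-]]; rewrite setTI; apply: open_borel.
exact/cf/interval_open.
Qed.

Section Volume.
Context {R : realType} {n : nat} {M : ptopologicalType} {S : @smooth_structure R n M}.
Variable g : riemannian_metric S.
Variable vol : {measure set (borel M) -> \bar R}.
Hypothesis Hvol : is_riemannian_volume g vol.

Lemma closed_box (a b : 'rV[R]_n) :
  closed [set x : 'rV[R]_n | forall i, a 0 i <= x 0 i <= b 0 i].
Proof.
rewrite (_ : mkset _ = \bigcap_(i in setT)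
    ((fun x : 'rV[R]_n => x 0 i) @^-1` `[a 0 i, b 0 i])); last first.
  apply/seteqP; split => x /= H i; last by have := H i I; rewrite /= in_itv.
  by move=> _; rewrite /= in_itv/=; exact: H.
apply: closed_bigI => i _; apply: closed_comp; last exact: interval_closed.
by move=> x _; exact: matrix_normedtype.coord_continuous.
Qed.

(** On a small coordinate ball the density is bounded by continuity, and the ball sits in a box of
    finite Lebesgue measure. *)
Lemma volume_locally_finite p :
  exists2 A : set M, open A /\ A p & (vol A < +oo)%E.
Proof.
have [L HL volE] := Hvol.
set c := chart_at S p.
have cp : dom c p by exact: chart_at_dom.
have Sc : atlas S c by exact: chart_at_atlas.
have cpc : (c @` dom c) (c p) by exists p.
pose B := Num.sqrt (\det (gmx g c (c p))) + 1.
have : \forall x \near c p, Num.sqrt (\det (gmx g c x)) < B.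
  apply: (continuous_near (f := fun x => Num.sqrt (\det (gmx g c x)))
    (A := [set y | y < B])).
    apply: (@continuous_comp _ _ _ (fun x => \det (gmx g c x)) (@Num.sqrt R)).
      by apply: det_continuous_at; exact: gmx_continuous_at.
    exact: sqrt_continuous.
  by apply: open_nbhs_nbhs; split; [exact: open_lt|rewrite /= ltrDl].
move=> /(@nbhs_normP R 'rV[R]_n _ _).1[r /= r0 rB].
pose O := [set x : 'rV[R]_n | `|c p - x| < r].
have oO : open O.
  rewrite (_ : O = ball (c p) r); first exact: ball_open.
  by rewrite -ball_normE.
pose A := dom c `&` (c @^-1` O).
have oA : open A.
  rewrite openE => q [cq Oq].
  have := chart_near_pullback cq (open_nbhs_nbhs (conj oO Oq)).
  by apply: filterS => z [].
exists A; first by split => //; split => //=; rewrite /O/= subrr normr0.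
rewrite (volE c)//; [|exact: open_borel|by move=> q []].
(* The norm is the sup norm, so this box contains the ball; [is_lebesgue_rV] prescribes L on
   boxes. *)
pose a := \row_i (c p 0 i - r); pose b := \row_i (c p 0 i + r).
pose D : set (borel 'rV[R]_n) := [set x : 'rV[R]_n | forall i, a 0 i <= x 0 i <= b 0 i].
have mD : measurable D by apply: closed_borel; exact: closed_box.
apply: (@le_lt_trans _ _ (\int[L]_(x in D) (cst B%:E x))%E).
  rewrite [leLHS]integral_mkcond [leRHS]integral_mkcond.
  apply: integral_mono => x _; rewrite /patch.
  have B0 : 0 <= B by rewrite addr_ge0 ?sqrtr_ge0.
  case: ifPn => [/set_mem[q [cq Oq] qx]|_].
    rewrite mem_set; first by rewrite lee_fin ltW// -qx; exact: rB.
    rewrite /D /= -qx => i; rewrite !mxE.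
    have : `|(c p - c q) 0 i| < r.
      apply: le_lt_trans Oq; rewrite [leRHS]/Num.Def.normr/= mx_normrE.
      exact: (le_bigmax 0 (fun ij : 'I_1 * 'I_n => `|(c p - c q) ij.1 ij.2|) (0, i)).
    by rewrite !mxE ltr_norml => /andP[? ?]; apply/andP; split; lra.
  by case: ifPn => // _; rewrite lee_fin.
rewrite integral_cst// HL.
  by rewrite -EFinM ltey.
by move=> i; rewrite !mxE; lra.
Qed.

Lemma volume_compact_finite (K : set M) : compact K ->
  exists2 A : set M, open A /\ K `<=` A & (vol A < +oo)%E.
Proof.
move=> cK.
(* [K] is near-covered along the filter of all sets containing some open set of
   finite volume. *)
pose F : set_system (set M) :=
  [set Q | exists2 A : set M, open A /\ (vol A < +oo)%E &
     forall B, A `<=` B -> Q B].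
have FF : Filter F.
  split.
  - by exists set0 => //; split; [exact: open0|rewrite measure0].
  - move=> P Q [A [oA Aoo] AP] [B [oB Boo] BQ].
    exists (A `|` B); last first.
      by move=> C ABC; split; [apply: AP|apply: BQ] => x ?; apply: ABC; [left|right].
    split; first exact: openU.
    apply: le_lt_trans (measureU2 _ (open_borel oA) (open_borel oB)) _.
    exact: lte_add_pinfty.
  - by move=> P Q PQ [A oA AP]; exists A => // B /AP/PQ.
have H := (compact_near_coveringP K).1 cK (set M) F (fun B x => B x) FF.
have [|A [oA Aoo] /(_ A (@subset_refl _ A)) KA] := H; last by exists A.
move=> p _; have [A [oA Ap] Aoo] := volume_locally_finite p.
exists (A, [set B | A `<=` B]) => /=.
  by split; [exact: open_nbhs_nbhs|exists A].
by move=> [q B] /= [Aq AB]; exact: AB.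
Qed.

End Volume.

(** * The weighted Hardy inequality *)

Lemma continuous_powR_pos (R : realType) (a x : R) : 0 < x ->
  {for x, continuous (fun y => y `^ a)}.
Proof.
move=> x0; have [dx _] := is_derive1_powR a x0.
exact/differentiable_continuous/derivable1_diffP.
Qed.

Lemma continuous_mul (R : realType) (T : topologicalType) (f h : T -> R) :
  continuous f -> continuous h -> continuous (fun p => f p * h p).
Proof. by move=> fc hc p; apply: (@continuousM _ _ f h p); [exact: fc|exact: hc]. Qed.

Lemma continuous_compact_bounded (R : realType) (T : topologicalType)
    (f : T -> R) (K : set T) : continuous f -> compact K ->
  exists2 L : R, 0 < L & forall p, K p -> f p <= L.
Proof.
move=> fc cK.
have H := (compact_near_coveringP K).1 cK R +oo (fun L x => f x <= L) _.
have : \forall L \near +oo, K `<=` [set x | f x <= L].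
  apply: H => p _; exists ([set q | f q < f p + 1], [set L | f p + 1 < L]) => /=.
    split; last exact: nbhs_pinfty_gt (num_real _).
    apply: (continuous_near (A := [set y | y < f p + 1]) (fc p)).
    by apply: open_nbhs_nbhs; split; [exact: open_lt|rewrite /= ltrDl].
  by move=> [q L] /= [fq L1]; rewrite ltW// (lt_trans fq).
move=> /(filterI (nbhs_pinfty_gt (num_real (0 : R))))/filter_ex[L /= [L0 KL]].
by exists L.
Qed.

Lemma weighted_AMGM (R : realFieldType) (x y b : R) : 0 < b ->
  2 * (x * y) <= b / 2 * x ^+ 2 + 2 / b * y ^+ 2.
Proof.
move=> b0; rewrite -subr_ge0.
rewrite (_ : _ - _ = 2 / b * (b * x / 2 - y) ^+ 2).
  by rewrite mulr_ge0 ?sqr_ge0// divr_ge0// ltW.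
by field; rewrite gt_eqF.
Qed.

Lemma ler_dist_lincomb (R : realDomainType) (x a c y d : R) :
  `|x - a * y| <= c * y + d -> (a - c) * y - d <= x <= (a + c) * y + d.
Proof. by rewrite ler_distl mulrBl mulrDl opprD !addrA. Qed.

(* [W] and [wt] are the weights V^(mu - lambda) and V^tau, [N] and [G] the
   norms of the gradients of rho and phi, [I] their inner product, and
   [s], [s1], [s2] are the powers alpha - 2, alpha - 1, alpha of [r = rho]. *)
Lemma hardy_algebra (R : realFieldType) (a f b W wt w r s s1 s2 I G N : R) :
  0 < b -> 0 < W -> 0 < wt -> 0 < r -> 0 <= s -> 0 <= G ->
  `|I| <= G * N -> W * N = 1 -> w = wt / W -> s1 = s * r -> s2 = s * r ^+ 2 ->
  `|W * (a * s * f ^+ 2 * N ^+ 2 + 2 * s1 * f * I) * wt - a * (s * f ^+ 2 * w)| <=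
  b / 2 * (s * f ^+ 2 * w) + 2 / b * (s2 * (W * G) ^+ 2 * w).
Proof.
move=> b0 W0 wt0 r0 s0 G0 IGN WN -> -> ->.
have WN0 : W != 0 by rewrite gt_eqF.
have bN0 : b != 0 by rewrite gt_eqF.
have NE : N = W^-1 by rewrite -[RHS]mulr1 -WN mulKf.
rewrite {}NE in IGN *.
(* Since N = 1 / W, the diagonal term equals a s f^2 w and cancels; only the cross term remains. *)
rewrite (_ : _ - _ = 2 * W * wt * s * r * (f * I)); last by field.
have c0 : 0 <= 2 * W * wt * s * r.
  apply: mulr_ge0; last exact: ltW.
  by apply: mulr_ge0 => //; rewrite ltW// !mulr_gt0.
rewrite normrM (ger0_norm c0) normrM.
apply: (@le_trans _ _ (2 * W * wt * s * r * (`|f| * (G / W)))).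
  by apply: ler_wpM2l => //; apply: ler_wpM2l.
(* Arranged for [weighted_AMGM] with x = |f| and y = r W G. *)
have -> : 2 * W * wt * s * r * (`|f| * (G / W)) =
    wt / W * s * (2 * (`|f| * (r * (W * G)))) by field.
rewrite (_ : b / 2 * _ + _ = wt / W * s *
    (b / 2 * `|f| ^+ 2 + 2 / b * (r * (W * G)) ^+ 2)).
  apply: ler_wpM2l (weighted_AMGM _ _ b0).
  by apply: mulr_ge0 => //; rewrite ltW// divr_gt0.
by rewrite real_normK ?num_real//; field; rewrite ?WN0 ?bN0.
Qed.

(** * The test function and the pointwise bound *)

Section Hardy.
Context {R : realType} {n : nat} {M : ptopologicalType} {S : @smooth_structure R n M}.
Variable g : riemannian_metric S.
Implicit Types (p : M) (f : M -> R).

Lemma grad_near0 f p : (\forall q \near p, f q = 0) -> grad g f p = 0.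
Proof.
move=> f0; rewrite /grad; case: asboolP => // df.
rewrite partialsE//; set P := chart_partials _ _ _.
suff -> : P = 0 by rewrite mul0mx.
apply/rowP => i; rewrite !mxE.
have E : \forall x \near chart_at S p p, (f \o param (chart_at S p)) x = cst 0 x.
  by have := chart_near (chart_at_dom S p) f0; apply: filterS => x [].
by rewrite (near_eq_derive _ E) derive_cst.
Qed.

Lemma near_notin_closure f p : ~ closure [set q | f q != 0] p ->
  \forall q \near p, f q = 0.
Proof.
move=> nKp; have : nbhs p (~` closure [set q | f q != 0]).
  by apply: open_nbhs_nbhs; split => //; apply: closed_openC; exact: closed_closure.
apply: filterS => q nAq; apply/eqP; apply: contraPT nAq => fq.
by apply; exact: subset_closure.
Qed.

Variables (u : M -> R) (lam mu : R) (rho phi : M -> R) (alpha : R).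
Hypotheses (Hu : smooth_fun S u) (Hphi : smooth_fun S phi).
Hypotheses (Hrho0 : forall p, 0 <= rho p) (Hrho : locally_lipschitz_fun g rho).
Hypothesis Hsupp : compactly_supported_in [set p | rho p != 0] phi.

Let K := closure [set p | phi p != 0].

Let w (p : M) : R := weight u (tau n lam mu + lam - mu) p.

(** The square is written as a product so that [lipschitz_nearM] applies to it. *)
Definition hardy_test p : R := rho p `^ (alpha - 1) * (phi p * phi p).

Definition hardy_weighted_sqr p : R := rho p `^ (alpha - 2) * phi p ^+ 2 * w p.

Definition hardy_weighted_grad p : R :=
  rho p `^ alpha * tnorm g p (affine_grad g u lam mu phi p) ^+ 2 * w p.

Lemma hardy_weighted_sqr_ge0 p : 0 <= hardy_weighted_sqr p.
Proof.
apply: mulr_ge0; last exact: powR_ge0.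
by apply: mulr_ge0; [exact: powR_ge0|exact: sqr_ge0].
Qed.

Lemma hardy_weighted_grad_ge0 p : 0 <= hardy_weighted_grad p.
Proof.
apply: mulr_ge0; last exact: powR_ge0.
by apply: mulr_ge0; [exact: powR_ge0|exact: sqr_ge0].
Qed.

Lemma rho_continuous : continuous rho.
Proof.
by move=> p; apply: lipschitz_near_continuous; exact: locally_lipschitz_near Hrho.
Qed.

Lemma weight_continuous (a : R) : continuous (weight u a).
Proof.
move=> p; apply: (@continuous_comp _ _ _ (expR \o u) (fun y => y `^ a)).
  apply: continuous_comp; first exact: (smooth_fun_continuous Hu).
  exact: continuous_expR.
by apply: continuous_powR_pos; exact: expR_gt0.
Qed.

Lemma powR_rhoD1 p : rho p != 0 ->
  rho p `^ (alpha - 1) = rho p `^ (alpha - 2) * rho p.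
Proof.
move=> rN0; rewrite -[X in _ = _ * X]powRr1 ?Hrho0// -powRD ?rN0 ?implybT//.
by congr (_ `^ _); ring.
Qed.

Lemma phi_near0 p : rho p = 0 -> \forall q \near p, phi q = 0.
Proof.
move=> r0; apply: near_notin_closure => /(Hsupp.2 _)/=.
by rewrite r0 eqxx.
Qed.

(** A power of rho may be discontinuous at the zeros of rho, but there the factor k vanishes on a
    whole neighbourhood. *)
Lemma powR_rho_continuous (a : R) (k : M -> R) : continuous k ->
  (forall p, rho p = 0 -> \forall q \near p, k q = 0) ->
  continuous (fun p => rho p `^ a * k p).
Proof.
move=> kc k0 p; have [r0|rN0] := eqVneq (rho p) 0.
  apply: (@near_eq_continuous _ _ (cst 0)); last exact: cst_continuous.
  by apply: filterS (k0 p r0) => q ->; rewrite mulr0.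
apply: (@continuousM _ _ (fun q => rho q `^ a) k p); last exact: kc.
apply: (@continuous_comp _ _ _ rho (fun y => y `^ a)); first exact: rho_continuous.
by apply: continuous_powR_pos; rewrite lt_def rN0 Hrho0.
Qed.

Lemma hardy_weighted_sqr_continuous : continuous hardy_weighted_sqr.
Proof.
rewrite (_ : hardy_weighted_sqr =
    (fun p => rho p `^ (alpha - 2) * (phi p * phi p * w p))).
  apply: powR_rho_continuous => [|p /phi_near0]; last first.
    by apply: filterS => q ->; rewrite !mul0r.
  apply: continuous_mul; last exact: weight_continuous.
  by apply: continuous_mul; exact: (smooth_fun_continuous Hphi).
by apply/funext => p; rewrite /hardy_weighted_sqr expr2 !mulrA.
Qed.

Lemma tnorm_affine_grad f p : tnorm g p (affine_grad g u lam mu f p) =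
  weight u (mu - lam) p * tnorm g p (grad g f p).
Proof. by rewrite tnormZ ger0_norm// powR_ge0. Qed.

Lemma hardy_weighted_grad_continuous : continuous hardy_weighted_grad.
Proof.
rewrite (_ : hardy_weighted_grad = (fun p => rho p `^ alpha *
    (weight u (mu - lam) p * weight u (mu - lam) p *
       tnorm g p (grad g phi p) ^+ 2 * w p))).
  apply: powR_rho_continuous => [|p /phi_near0/nbhs_interior]; last first.
    apply: filterS => q phi0; rewrite sqr_tnorm grad_near0//.
    by rewrite /inner !mul0mx mxE mulr0 mul0r.
  apply: continuous_mul; last exact: weight_continuous.
  apply: continuous_mul; last exact: sqr_tnorm_grad_continuous.
  by apply: continuous_mul; exact: weight_continuous.
apply/funext => p; rewrite /hardy_weighted_grad tnorm_affine_grad exprMn expr2.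
by rewrite !mulrA.
Qed.

(** The gradient is bounded on the compact support by continuity and vanishes off it. *)
Lemma phi_lipschitz : lipschitz_fun g phi.
Proof.
have gphic := sqr_tnorm_grad_continuous (g := g) Hphi.
have [L L0 KL] := continuous_compact_bounded gphic Hsupp.1.
exists (Num.sqrt L); apply: smooth_lipschitz => //; first by rewrite sqrtr_gt0.
move=> p; have [/KL pL|/near_notin_closure/grad_near0 ->] := pselect (K p).
  rewrite -(@ler_pXn2r _ 2) ?nnegrE ?tnorm_ge0 ?sqrtr_ge0//.
  by rewrite [leRHS]sqr_sqrtr ?(ltW L0)//.
by rewrite /tnorm /inner !mul0mx mxE sqrtr0 sqrtr_ge0.
Qed.

Lemma hardy_test_near0 p : (\forall q \near p, phi q = 0) ->
  \forall q \near p, hardy_test q = 0.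
Proof. by apply: filterS => q; rewrite /hardy_test => ->; rewrite !mulr0. Qed.

Lemma hardy_test_function : test_function g rho hardy_test.
Proof.
have suppS : closure [set p | hardy_test p != 0] `<=` K.
  apply: closureS => p /=; rewrite /hardy_test; apply: contraNN => /eqP ->.
  by rewrite !mulr0.
have cpt : compact (closure [set p | hardy_test p != 0]).
  by apply: (subclosed_compact _ Hsupp.1 suppS); exact: closed_closure.
split.
- by move=> p; rewrite mulr_ge0 ?powR_ge0// -expr2 sqr_ge0.
- apply: compactly_supported_lipschitz cpt => p.
  (* At a zero of rho the test function is locally 0; elsewhere the power is differentiable with
     continuous derivative near rho p > 0. *)
  have [r0|rN0] := eqVneq (rho p) 0.
    exact: lipschitz_near_cst_near (hardy_test_near0 (phi_near0 r0)).
  have rp : 0 < rho p by rewrite lt_def rN0 Hrho0.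
  apply: lipschitz_nearM; last first.
    by apply: lipschitz_nearM; exact: lipschitz_fun_near phi_lipschitz.
  apply: (lipschitz_near_comp (F := fun y => y `^ (alpha - 1))
      (dF := fun y => (alpha - 1) * y `^ (alpha - 1 - 1))).
  + exact: locally_lipschitz_near.
  + have : \forall x \near rho p, 0 < x.
      by apply: open_nbhs_nbhs; split => //; exact: open_gt.
    by apply: filterS => x x0; exact: is_derive1_powR.
  + apply: continuousM; first exact: cst_continuous.
    exact: continuous_powR_pos.
- split => //; apply: subset_trans suppS _; exact: Hsupp.2.
Qed.

Lemma inner_grad_hardy_test p v : mdifferentiable (S:=S) rho p -> 0 < rho p ->
  inner g p (grad g hardy_test p) v =
  (alpha - 1) * rho p `^ (alpha - 2) * phi p ^+ 2 * inner g p (grad g rho p) v +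
  2 * rho p `^ (alpha - 1) * phi p * inner g p (grad g phi p) v.
Proof.
move=> dr rp.
set c := chart_at S p; set x := c p.
have cp : dom c p by exact: chart_at_dom.
have xp : param c x = p by exact: coordK.
have df : differentiable (phi \o param c) x.
  exact: smooth_fun_differentiable (chart_at_atlas S p) cp.
pose r := rho \o param c; pose f := phi \o param c.
have rx0 : 0 < r x by rewrite /r/= xp.
have [dF EF] := is_derive1_powR (alpha - 1) rx0.
have dF' : differentiable (fun y : R => y `^ (alpha - 1)) (r x).
  exact/derivable1_diffP.
have dFr : differentiable ((fun y : R => y `^ (alpha - 1)) \o r) x.
  exact: differentiable_comp.
have isF : is_derive x v ((fun y : R => y `^ (alpha - 1)) \o r)
    ((alpha - 1) * r x `^ (alpha - 2) * 'd r x v).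
  split; first exact: diff_derivable.
  rewrite deriveE//.
  have /(congr1 (@^~ v)) -> := diff_comp (dr : differentiable r x) dF'.
  rewrite /= -[X in 'd _ _ X = _]mulr1 -[X in 'd _ _ X = _]/('d r x v *: 1) linearZ/=.
  move: EF; rewrite (deriveE _ dF') => ->; rewrite [LHS]mulrC; congr (_ * _ `^ _ * _).
  by rewrite -addrA -opprD.
have isf : is_derive x v f ('d f x v).
  by split; [exact: diff_derivable|rewrite deriveE].
have isP : is_derive x v (hardy_test \o param c)
  ((alpha - 1) * rho p `^ (alpha - 2) * phi p ^+ 2 * 'd r x v +
   2 * rho p `^ (alpha - 1) * phi p * 'd f x v).
  apply: (@is_derive_eq _ _ _ (((fun y : R => y `^ (alpha - 1)) \o r) * (f * f))).
  have rxp : r x = rho p by rewrite /r /= xp.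
  have fxp : f x = phi p by rewrite /f /= xp.
  rewrite /GRing.scale /= fctE /= rxp fxp.
  by move: (powR _ _) (powR _ _) ('d r x v) ('d f x v) => a1 a2 a3 a4; ring.
have dP : mdifferentiable (S:=S) hardy_test p.
  have : differentiable (((fun y : R => y `^ (alpha - 1)) \o r) * (f * f)) x.
    by apply: differentiableM => //; exact: differentiableM.
  exact.
apply: etrans (inner_grad g v dP) _.
have [_ H] := isP; apply: etrans (etrans (esym (deriveE v dP)) H) _.
congr (_ * _ + _ * _); apply: esym; first exact: (inner_grad g v dr).
exact: (inner_grad g v df).
Qed.

(** The integrand of [weak_affine_laplacian] for [hardy_test], without the outer sign. *)
Definition hardy_pairing p : R :=
  inner g p (grad g hardy_test p) (affine_grad g u lam mu rho p) *
  weight u (tau n lam mu) p.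

(** The bound is two-sided: its upper half serves the case of an upper Laplacian bound, its lower
    half the other case. *)
Lemma hardy_pairing_bound p (b : R) : 0 < b ->
  tnorm g p (affine_grad g u lam mu rho p) = 1 ->
  `|hardy_pairing p - (alpha - 1) * hardy_weighted_sqr p| <=
    b / 2 * hardy_weighted_sqr p + 2 / b * hardy_weighted_grad p.
Proof.
move=> b0 unit1.
have w0 q a : 0 < weight u a q by rewrite powR_gt0// expR_gt0.
have [r0|rN0] := eqVneq (rho p) 0.
  have phi0 := phi_near0 r0.
  rewrite /hardy_pairing (grad_near0 (hardy_test_near0 phi0)) /inner !mul0mx mxE.
  rewrite /hardy_weighted_sqr (nbhs_singleton phi0) expr0n/= mulr0 !mul0r mulr0.
  rewrite mulr0 subrr normr0 add0r mulr_ge0 ?divr_ge0 ?(ltW b0)//.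
  exact: hardy_weighted_grad_ge0.
have rp : 0 < rho p by rewrite lt_def rN0 Hrho0.
(* Otherwise [grad] takes its default value 0, against the norm being 1. *)
have dr : mdifferentiable (S:=S) rho p.
  apply: contrapT => ndr; move: unit1; rewrite tnorm_affine_grad /grad asboolF//.
  by rewrite /tnorm /inner !mul0mx mxE sqrtr0 mulr0 => /eqP; rewrite eq_sym oner_eq0.
move: unit1; rewrite tnorm_affine_grad.
rewrite /hardy_pairing /hardy_weighted_sqr /hardy_weighted_grad tnorm_affine_grad.
rewrite [affine_grad _ _ _ _ rho _]/affine_grad innerZr.
have -> : inner g p (grad g hardy_test p) (grad g rho p) =
    (alpha - 1) * rho p `^ (alpha - 2) * phi p ^+ 2 * tnorm g p (grad g rho p) ^+ 2 +
    2 * rho p `^ (alpha - 1) * phi p * inner g p (grad g phi p) (grad g rho p).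
  by rewrite sqr_tnorm; exact: inner_grad_hardy_test.
have := inner_CauchySchwarz g p (grad g phi p) (grad g rho p).
move=> IGN WN.
apply: (hardy_algebra (alpha - 1) (phi p) b0 (w0 p (mu - lam)) (w0 p (tau n lam mu))
  rp (powR_ge0 (rho p) (alpha - 2)) (tnorm_ge0 g p _) IGN WN).
- rewrite /w /weight -powRB; last by rewrite (gt_eqF (expR_gt0 _)) implybT.
  by rewrite opprB addrA.
- exact: powR_rhoD1.
- by rewrite -powR_mulrn ?Hrho0// -powRD ?rN0 ?implybT// subrK.
Qed.

Variable vol : {measure set (borel M) -> \bar R}.
Hypothesis Hvol : is_riemannian_volume g vol.

(** The function is continuous, bounded, and zero outside an open set of finite volume containing
    the support of phi. *)
Lemma hardy_weighted_sqr_integrable :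
  vol.-integrable setT (EFin \o hardy_weighted_sqr).
Proof.
have Ac := hardy_weighted_sqr_continuous.
have mA := continuous_borel Ac.
have [V [oV KV] Voo] := volume_compact_finite Hvol Hsupp.1.
have mV := open_borel oV.
have A0 p : ~ V p -> hardy_weighted_sqr p = 0.
  move=> nVp; rewrite /hardy_weighted_sqr (_ : phi p = 0) ?expr0n/= ?mulr0 ?mul0r//.
  by apply: nbhs_singleton (near_notin_closure _) => /KV.
have [L L0 KL] := continuous_compact_bounded Ac Hsupp.1.
have AL p : hardy_weighted_sqr p <= L.
  have [/KL//|nKp] := pselect (K p).
  rewrite /hardy_weighted_sqr (nbhs_singleton (near_notin_closure nKp)).
  by rewrite expr0n/= mulr0 mul0r ltW.
have /(integrable_mkcond _ mV) : vol.-integrable V (EFin \o hardy_weighted_sqr).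
  apply: measurable_bounded_integrable => //; first exact: measurable_funTS.
  exists L; split; first exact: num_real.
  move=> r Lr p _ /=; rewrite ger0_norm ?hardy_weighted_sqr_ge0//.
  by rewrite (le_trans (AL p))// ltW.
apply: eq_integrable => // p _; rewrite /patch; case: ifPn => // /negP nVp.
by rewrite /= A0// => Vp; apply: nVp; rewrite inE.
Qed.

Lemma laplacian_bound_hardy_test (C : R) :
  laplacian_bound (n := n) vol u lam mu C rho hardy_test =
  (C%:E * \int[vol]_p (hardy_weighted_sqr p)%:E)%E.
Proof.
rewrite -integralZl//; last exact: hardy_weighted_sqr_integrable.
apply: eq_integral => p _; rewrite -EFinM; congr (_%:E).
rewrite /hardy_test /hardy_weighted_sqr /w.
(* The division by rho merges into the power only where rho is nonzero; at its zeros phi is 0. *)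
have [r0|rN0] := eqVneq (rho p) 0.
  by rewrite (nbhs_singleton (phi_near0 r0)) expr0n/= !(mulr0, mul0r).
by rewrite powR_rhoD1//; field.
Qed.

Hypothesis Hunit :
  {ae vol, forall p, tnorm g p (affine_grad g u lam mu rho p) = 1}.

Let mgrad : measurable_fun (setT : set (borel M)) hardy_weighted_grad.
Proof. exact: continuous_borel hardy_weighted_grad_continuous. Qed.

Lemma hardy_le (C : R) : 0 < 1 - alpha - C ->
  affine_laplacian_le g vol u lam mu C rho ->
  ((((1 - alpha - C) / 2) ^+ 2)%:E * \int[vol]_p (hardy_weighted_sqr p)%:E
    <= \int[vol]_p (hardy_weighted_grad p)%:E)%E.
Proof.
move=> b0 /(_ _ hardy_test_function); rewrite laplacian_bound_hardy_test => HC.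
have FG : {ae vol, forall p : borel M,
    hardy_pairing p <= (alpha - 1 + (1 - alpha - C) / 2) * hardy_weighted_sqr p +
      2 / (1 - alpha - C) * hardy_weighted_grad p}.
  (* The AM-GM weight is b = 1 - alpha - C, and the upper half of the bound is kept. *)
  apply: (@filterS _ _ (ae_filter_ringOfSetsType vol)) Hunit => p.
  move=> /(hardy_pairing_bound b0).
  by move=> /ler_dist_lincomb/andP[].
exact: (hardy_of_laplacian_le hardy_weighted_sqr_integrable mgrad
  hardy_weighted_grad_ge0 b0 FG HC).
Qed.

Lemma hardy_ge (C : R) : 0 < alpha + C - 1 ->
  affine_laplacian_ge g vol u lam mu C rho ->
  ((((alpha + C - 1) / 2) ^+ 2)%:E * \int[vol]_p (hardy_weighted_sqr p)%:E
    <= \int[vol]_p (hardy_weighted_grad p)%:E)%E.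
Proof.
move=> b0 /(_ _ hardy_test_function); rewrite laplacian_bound_hardy_test => HC.
have FG : {ae vol, forall p : borel M,
    (alpha - 1 - (alpha + C - 1) / 2) * hardy_weighted_sqr p -
      2 / (alpha + C - 1) * hardy_weighted_grad p <= hardy_pairing p}.
  (* Here b = alpha + C - 1, with the lower half of the bound. *)
  apply: (@filterS _ _ (ae_filter_ringOfSetsType vol)) Hunit => p.
  move=> /(hardy_pairing_bound b0).
  by move=> /ler_dist_lincomb/andP[].
exact: (hardy_of_laplacian_ge hardy_weighted_sqr_integrable mgrad
  hardy_weighted_grad_ge0 b0 FG HC).
Qed.

End Hardy.

Theorem theorem3p1 (R : realType) (n : nat) (M : ptopologicalType)
    (S : @smooth_structure R n M) (g : riemannian_metric S)
    (vol : {measure set (borel M) -> \bar R})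
    (Hvol : is_riemannian_volume g vol)
    (Hcomplete : complete_metric g) (Hnoncompact : ~ compact [set: M])
    (u : M -> R) (Hu : smooth_fun S u) (lam mu : R)
    (rho : M -> R) (Hrho0 : forall p, 0 <= rho p)
    (Hrho : unit_affine_grad g vol u lam mu rho)
    (alpha : R) (phi : M -> R) (Hphi : smooth_fun S phi)
    (Hsupp : compactly_supported_in [set p | rho p != 0] phi) :
  (forall C : R, 0 < C -> 0 < 1 - alpha - C ->
     affine_laplacian_le g vol u lam mu C rho ->
     ((((1 - alpha - C) / 2) ^+ 2)%:E *
        \int[vol]_p (rho p `^ (alpha - 2) * phi p ^+ 2 *
                     weight u (tau n lam mu + lam - mu) p)%:E
      <= \int[vol]_p (rho p `^ alpha *
                      tnorm g p (affine_grad g u lam mu phi p) ^+ 2 *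
                      weight u (tau n lam mu + lam - mu) p)%:E)%E) /\
  (forall C : R, 0 < C -> 0 < C + alpha - 1 ->
     affine_laplacian_ge g vol u lam mu C rho ->
     ((((alpha + C - 1) / 2) ^+ 2)%:E *
        \int[vol]_p (rho p `^ (alpha - 2) * phi p ^+ 2 *
                     weight u (tau n lam mu + lam - mu) p)%:E
      <= \int[vol]_p (rho p `^ alpha *
                      tnorm g p (affine_grad g u lam mu phi p) ^+ 2 *
                      weight u (tau n lam mu + lam - mu) p)%:E)%E).
Proof.
have [Hlip Hunit] := Hrho.
split=> C C0 b0 HC.
  exact: (hardy_le (u := u) Hu Hphi Hrho0 Hlip Hsupp Hvol Hunit b0 HC).
have {}b0 : 0 < alpha + C - 1 by rewrite [alpha + C]addrC.
exact: (hardy_ge (u := u) Hu Hphi Hrho0 Hlip Hsupp Hvol Hunit b0 HC).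
Qed.
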